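(* Let $c\in(0,1/2)$, let $r\in\{3,4\}$, and let $n$ be an integer with $r\le \xi(c)\le n$. Then $\varphi_r(n,c)=\varphi_r(c)$.
   Context: For integers $1\le r\le n$, let $[n]=\{1,\dots,n\}$ and let $\binom{[n]}{r}$ be the set of $r$-subsets of $[n]$. For a real symmetric $n\times n$ matrix $A=(a_{ij})$ and a real vector $\mathbf{x}=(x_1,\dots,x_n)$ set $$L_r(A,\mathbf{x})=\sum_{X\in\binom{[n]}{r}}\ \prod_{i,j\in X,\ i<j}a_{ij}\ \prod_{i\in X}x_i .$$ In particular $L_1(A,\mathbf{x})=\sum_i x_i$ and $L_2(A,\mathbf{x})=\sum_{i<j}a_{ij}x_ix_j$. Let $\mathcal{A}(n)$ be the set of real symmetric $n\times n$ matrices $A=(a_{ij})$ with $a_{ii}=0$ and $0\le a_{ij}=a_{ji}\le 1$ for all $i,j\in[n]$. For $c>0$ let $$\mathcal{S}_n(c)=\{(A,\mathbf{x}): A\in\mathcal{A}(n),\ \mathbf{x}\in\mathbb{R}^n,\ \mathbf{x}\ge 0 \text{ entrywise},\ L_1(A,\mathbf{x})=1,\ L_2(A,\mathbf{x})=c\}.$$ For $0<c<1/2$ put $\xi(c)=\lceil 1/(1-2c)\rceil$. For $c\in(0,1/2)$, $n\ge \xi(c)$ and $3\le r\le n$ define $$\varphi_r(n,c)=\min\{L_r(A,\mathbf{x}):\ r\le k\le n,\ (A,\mathbf{x})\in\mathcal{S}_k(c)\},$$ the minimum being over all integers $k$ with $r\le k\le n$ and all pairs in $\mathcal{S}_k(c)$.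 For $c\in(0,1/2)$ let $s=\xi(c)$ and $$x=\frac1s+\frac1s\sqrt{1-\frac{2s}{s-1}c},\qquad y=\frac1s-\frac{s-1}{s}\sqrt{1-\frac{2s}{s-1}c}$$ (the unique solution of $\binom{s-1}{2}x^2+(s-1)xy=c$, $(s-1)x+y=1$, $x\ge y$). Let $\mathbf{x}_c$ be the $s$-vector $(x,\dots,x,y)$ and $A_s\in\mathcal{A}(s)$ the matrix with all off-diagonal entries equal to $1$. Define $\varphi_r(c)=L_r(A_s,\mathbf{x}_c)$; explicitly $$\varphi_r(c)=\binom{s-1}{r}x^r+\binom{s-1}{r-1}x^{r-1}y .$$ *)

(* Defs.v *)
From mathcomp Require Import all_boot all_order all_algebra.
From mathcomp Require Import classical_sets reals.
Set Implicit Arguments.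
Unset Strict Implicit.
Unset Printing Implicit Defensive.
Import Order.TTheory GRing.Theory Num.Theory.
Local Open Scope classical_set_scope.
Local Open Scope ring_scope.

Definition Lr (R : realType) (n r : nat) (A : 'M[R]_n) (x : 'rV[R]_n) : R :=
  \sum_(X : {set 'I_n} | #|X| == r)
    (\prod_(i in X) \prod_(j in X | (i < j)%N) A i j) * \prod_(i in X) x 0 i.

Definition weight_matrices (R : realType) (n : nat) : set 'M[R]_n :=
  [set A | [/\ A^T = A, forall i, A i i = 0 & forall i j, 0 <= A i j <= 1]].

Definition Sn (R : realType) (n : nat) (c : R) :
    set ('M[R]_n * 'rV[R]_n)%type :=
  [set Ax : 'M[R]_n * 'rV[R]_n |
    [/\ weight_matrices Ax.1, forall i, 0 <= Ax.2 0 i,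
        Lr 1 Ax.1 Ax.2 = 1 & Lr 2 Ax.1 Ax.2 = c]].

(* The absolute value only casts [int] to [nat]: the ceiling is positive for
   0 < c < 1/2. *)
Definition xi (R : realType) (c : R) : nat := `|Num.ceil (1 / (1 - 2 * c))|%N.

(* The values whose minimum is phi_r(n, c). *)
Definition phi_values (R : realType) (r n : nat) (c : R) : set R :=
  [set v | exists k : nat, (r <= k <= n)%N /\
     exists Ax : 'M[R]_k * 'rV[R]_k, Sn c Ax /\ v = Lr r Ax.1 Ax.2].

Definition is_minimum (R : realType) (E : set R) (m : R) : Prop :=
  E m /\ lbound E m.

(* With s = xi c, the pair (x, y) = (xc_big c, xc_small c) is the solution of
   'C(s - 1, 2) x^2 + (s - 1) x y = c and (s - 1) x + y = 1 with y <= x, i.e.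
   (complete_mx R s, (x, ..., x, y)) lies in Sn c. *)
Definition xc_big (R : realType) (c : R) : R :=
  let s := (xi c)%:R in
  1 / s + 1 / s * Num.sqrt (1 - 2 * s / (s - 1) * c).

Definition xc_small (R : realType) (c : R) : R :=
  let s := (xi c)%:R in
  1 / s - (s - 1) / s * Num.sqrt (1 - 2 * s / (s - 1) * c).

Definition xc (R : realType) (c : R) : 'rV[R]_(xi c) :=
  \row_(i < xi c) (if (i.+1 < xi c)%N then xc_big c else xc_small c).

Definition complete_mx (R : realType) (n : nat) : 'M[R]_n :=
  \matrix_(i < n, j < n) (i != j)%:R.

Definition phi (R : realType) (r : nat) (c : R) : R :=
  Lr r (complete_mx R (xi c)) (xc c).

(* Main.v *)
Require Import Defs.
From mathcomp Require Import all_boot all_order all_algebra.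
From mathcomp Require Import boolp classical_sets reals topology normedtype derive.
From mathcomp Require Import ring lra.
Set Implicit Arguments.
Unset Strict Implicit.
Unset Printing Implicit Defensive.
Import Order.TTheory GRing.Theory Num.Theory.
Import numFieldNormedType.Exports.
Local Open Scope ring_scope.

(** Write W_r for r! L_r ([clq r]), and for each m let p in [1/(m+1), 1/m]
    parametrize the edge weights c2 m p between the Turan values of m and m + 1 parts, so that
    the bound to prove is W_r >= f_r(m, p) whenever W_2 >= c2 m p.  At the two
    ends of the interval this is Goodman's inequality, resp. the Moon-Moser
    inequality.  In the interior, consider a minimizer (A, x, p); multiplier
    rules for moving x towards a vertex and for decreasing entries of A express
    the number of (r-1)-cliques in the link of a vertex through its degree and
    bound its degree.

    Triangles (r = 3): weighting the edge condition by the set of common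
    non-neighbours gives an upper bound on W_4 (after Razborov).  For m = 2 it
    contradicts W_4 >= 0.  For larger m, W_4 is bounded from below by applying
    the triangle bound for m - 1 to the links.  There one minimizes the ratio
    W_3 / f_3 instead of the difference, which makes the degree bound exact.

    K_4 (r = 4): the triangle bound for m - 1, applied to the links, shows that
    each link of a vertex has too few edges; hence there are fewer triangles
    than the triangle bound for m allows. *)

(** * Sums over ordered cliques *)

Section CliqueSums.
Context {R : realType} {T : finType}.
Implicit Types (a : T -> T -> R) (x : T -> R).

Definition link a x (i : T) : T -> R := fun j => a i j * x j.

(* [clq r a x] is r! L_r(a, x), summed over ordered cliques. *)
Fixpoint clq (r : nat) a x : R :=
  if r is r'.+1 then \sum_i x i * clq r' a (link a x i) else 1.

Arguments clq : simpl never.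

Lemma clq0 a x : clq 0 a x = 1.
Proof. by []. Qed.

Lemma clqS r a x : clq r.+1 a x = \sum_i x i * clq r a (link a x i).
Proof. by []. Qed.

Definition weighting a : Prop :=
  [/\ forall i j, a i j = a j i, forall i, a i i = 0
    & forall i j, 0 <= a i j <= 1].

Definition deg a x (i : T) : R := \sum_v a i v * x v.

Definition codeg a x (i j : T) : R := \sum_v a i v * a j v * x v.

Lemma clq_scale r a x (s : R) : clq r a (fun i => s * x i) = s ^+ r * clq r a x.
Proof.
elim: r x => [|r IHr] x; first by rewrite expr0 mul1r.
rewrite !clqS mulr_sumr; apply: eq_bigr => i _.
have -> : link a (fun k => s * x k) i = (fun k => s * link a x i k).
  by apply/funext => k; rewrite /link mulrCA.
by rewrite IHr exprS; ring.
Qed.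

Lemma linkC a x i j : link a (link a x i) j = link a (link a x j) i.
Proof. by apply/funext => k; rewrite /link mulrCA. Qed.

Lemma clq_ge0 r a x : (forall i j, 0 <= a i j) -> (forall i, 0 <= x i) ->
  0 <= clq r a x.
Proof.
move=> a0; elim: r x => [|r IHr] x x0; first by rewrite clq0.
rewrite clqS; by apply: sumr_ge0 => i _; rewrite mulr_ge0 // IHr // => j; rewrite mulr_ge0.
Qed.

(* No vertex occurs twice in a clique, so [clq r.+1] is affine in each
   coordinate. *)
Lemma clq_shift r a x i (s t : R) : weighting a ->
  clq r.+1 a (fun k => s * x k + t * (k == i)%:R) =
  s ^+ r.+1 * clq r.+1 a x + r.+1%:R * t * s ^+ r * clq r a (link a x i).
Proof.
case=> asym aii _; elim: r x t => [|r IHr] x t.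
  rewrite !clqS expr1 expr0 clq0 !mul1r !mulr1.
  under eq_bigr do rewrite clq0 mulr1.
  rewrite big_split /= -mulr_sumr -mulr_sumr; congr (_ * _ + _).
    by apply: eq_bigr => j _; rewrite clq0 mulr1.
  by rewrite (bigD1 i) //= eqxx big1 ?addr0 ?mulr1 // => j /negPf ->.
rewrite clqS.
have lnk j : link a (fun k => s * x k + t * (k == i)%:R) j =
    (fun k => s * link a x j k + (t * a j i) * (k == i)%:R).
  apply/funext => k; rewrite /link; case: eqP => [->|_]; last by rewrite !mulr0 !addr0; ring.
  by rewrite !mulr1; ring.
have W1 j : clq r.+1 a (link a (fun k => s * x k + t * (k == i)%:R) j) =
   s ^+ r.+1 * clq r.+1 a (link a x j)
     + r.+1%:R * (t * a j i) * s ^+ r * clq r a (link a (link a x j) i).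
  by rewrite lnk IHr.
transitivity (\sum_j (s * x j * (s ^+ r.+1 * clq r.+1 a (link a x j)) +
     (r.+1%:R * t * s ^+ r.+1) * (link a x i j * clq r a (link a (link a x i) j)))
   + \sum_j (j == i)%:R * (t * (s ^+ r.+1 * clq r.+1 a (link a x i)))).
  rewrite -big_split; apply: eq_bigr => j _; rewrite W1 linkC /=.
  have [->|ji] := eqVneq j i; last first.
    rewrite mulr0 addr0 mul0r addr0 (_ : link a x i j = a j i * x j) ?(exprS s r); last by rewrite /link asym.
    by ring.
  by rewrite (_ : link a x i i = 0) ?aii ?/link ?aii ?mul0r //; ring.
rewrite -mulr_suml (_ : \sum_j (j == i)%:R = 1); last first.
  by rewrite (bigD1 i) //= eqxx big1 ?addr0 // => j /negPf ->.
rewrite mul1r.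
rewrite big_split /= -mulr_sumr -clqS (clqS r.+1).
under eq_bigr do rewrite mulrACA -exprS.
rewrite -mulr_sumr -(natr1 r.+1); ring.
Qed.
End CliqueSums.
Arguments clq {R T} r a x : simpl never.

(** * The Goodman and Moon-Moser inequalities, by sums over edges and triangles *)

Section CliqueInequalities.
Context {R : realType} {T : finType}.
Implicit Types (a : T -> T -> R) (x : T -> R).

(* If each pair is multiplied by the factors of its two ends, each vertex of an
   r-clique collects its own factor r - 1 times. *)
Lemma clq_vertex_factors r a x (s : T -> R) :
  clq r.+1 (fun i j => a i j * (s i * s j)) x =
  clq r.+1 a (fun i => s i ^+ r * x i).
Proof.
elim: r x => [|r IHr] x.
  by rewrite !clqS; apply: eq_bigr => i _; rewrite expr0 mul1r.
rewrite clqS [RHS]clqS; apply: eq_bigr => i _; rewrite IHr.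
set y := link a (fun k => s k ^+ r.+1 * x k) i.
rewrite (_ : (fun _ => _) = (fun k => s i * y k)).
  by rewrite clq_scale (exprS (s i)); ring.
by apply/funext => k; rewrite /y /link exprS; ring.
Qed.

(** Integrals against the measures on ordered edges and, for [tri_sum], ordered triangles, whose
    total masses are [clq 2] and [clq 3]. *)
Definition edge_sum a x (f : T -> T -> R) : R :=
  \sum_i \sum_j x i * x j * a i j * f i j.

Definition tri_sum a x (f : T -> T -> T -> R) : R :=
  \sum_i \sum_j \sum_k x i * x j * x k * (a i j * a i k * a j k) * f i j k.

Lemma edge_sumD a x f g :
  edge_sum a x (fun i j => f i j + g i j) = edge_sum a x f + edge_sum a x g.
Proof.
rewrite /edge_sum -big_split; apply: eq_bigr => i _.
by rewrite -big_split; apply: eq_bigr => j _; rewrite mulrDr.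
Qed.

Lemma edge_sumZ a x c f :
  edge_sum a x (fun i j => c * f i j) = c * edge_sum a x f.
Proof.
rewrite /edge_sum mulr_sumr; apply: eq_bigr => i _.
by rewrite mulr_sumr; apply: eq_bigr => j _; rewrite mulrCA.
Qed.

Lemma edge_sum_le a x f g :
  (forall i j, 0 <= a i j) -> (forall i, 0 <= x i) ->
  (forall i j, f i j <= g i j) -> edge_sum a x f <= edge_sum a x g.
Proof.
move=> a0 x0 fg; apply: ler_sum => i _; apply: ler_sum => j _.
by rewrite ler_wpM2l // !mulr_ge0.
Qed.

Lemma tri_sumD a x f g :
  tri_sum a x (fun i j k => f i j k + g i j k) = tri_sum a x f + tri_sum a x g.
Proof.
rewrite /tri_sum -big_split; apply: eq_bigr => i _.
rewrite -big_split; apply: eq_bigr => j _.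
by rewrite -big_split; apply: eq_bigr => k _; rewrite mulrDr.
Qed.

Lemma tri_sumZ a x c f :
  tri_sum a x (fun i j k => c * f i j k) = c * tri_sum a x f.
Proof.
rewrite /tri_sum mulr_sumr; apply: eq_bigr => i _.
rewrite mulr_sumr; apply: eq_bigr => j _.
by rewrite mulr_sumr; apply: eq_bigr => k _; rewrite mulrCA.
Qed.

Lemma tri_sum_le a x f g :
  (forall i j, 0 <= a i j) -> (forall i, 0 <= x i) ->
  (forall i j k, f i j k <= g i j k) -> tri_sum a x f <= tri_sum a x g.
Proof.
move=> a0 x0 fg.
apply: ler_sum => i _; apply: ler_sum => j _; apply: ler_sum => k _.
by rewrite ler_wpM2l // !mulr_ge0.
Qed.

Lemma edge_sumC a x f : weighting a ->
  edge_sum a x (fun i j => f j i) = edge_sum a x f.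
Proof.
move=> [asym _ _]; rewrite /edge_sum exchange_big /=.
by apply: eq_bigr => i _; apply: eq_bigr => j _; rewrite (asym j i); ring.
Qed.

Lemma tri_sumC12 a x f : weighting a ->
  tri_sum a x (fun i j k => f j i k) = tri_sum a x f.
Proof.
move=> [asym _ _]; rewrite /tri_sum exchange_big /=.
apply: eq_bigr => i _; apply: eq_bigr => j _; apply: eq_bigr => k _.
by rewrite (asym j i); ring.
Qed.

Lemma tri_sumC23 a x f : weighting a ->
  tri_sum a x (fun i j k => f i k j) = tri_sum a x f.
Proof.
move=> [asym _ _]; rewrite /tri_sum; apply: eq_bigr => i _.
rewrite exchange_big /=; apply: eq_bigr => j _; apply: eq_bigr => k _.
by rewrite (asym k j); ring.
Qed.

Lemma clq1E a x : clq 1 a x = \sum_i x i.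
Proof. by rewrite clqS; apply: eq_bigr => i _; rewrite clq0 mulr1. Qed.

Lemma clq1_link a x i : clq 1 a (link a x i) = deg a x i.
Proof. by rewrite clq1E. Qed.

Lemma clq2E a x : clq 2 a x = \sum_i x i * deg a x i.
Proof. by rewrite clqS; apply: eq_bigr => i _; rewrite clq1_link. Qed.

Lemma clq2_edge a x : clq 2 a x = edge_sum a x (fun _ _ => 1).
Proof.
rewrite clq2E; apply: eq_bigr => i _; rewrite mulr_sumr.
by apply: eq_bigr => j _; ring.
Qed.

Lemma clq3_edge a x : clq 3 a x = edge_sum a x (codeg a x).
Proof.
rewrite clqS; apply: eq_bigr => i _; rewrite clq2E mulr_sumr.
apply: eq_bigr => j _; rewrite /link -!mulrA; congr (_ * _).
rewrite mulrCA; congr (_ * (_ * _)).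
by apply: eq_bigr => k _; ring.
Qed.

Lemma edge_tri_sum a x f :
  edge_sum a x (fun i j => codeg a x i j * f i j) =
  tri_sum a x (fun i j _ => f i j).
Proof.
apply: eq_bigr => i _; apply: eq_bigr => j _.
rewrite mulr_suml mulr_sumr; apply: eq_bigr => k _.
by ring.
Qed.

Lemma clq3_tri a x : clq 3 a x = tri_sum a x (fun _ _ _ => 1).
Proof.
rewrite -edge_tri_sum clq3_edge; congr edge_sum.
by apply/funext => i; apply/funext => j; rewrite mulr1.
Qed.

Lemma clq4_tri a x :
  clq 4 a x = tri_sum a x (fun i j k => \sum_v a i v * a j v * a k v * x v).
Proof.
rewrite clqS; apply: eq_bigr => i _; rewrite clq3_edge mulr_sumr.
apply: eq_bigr => j _; rewrite mulr_sumr; apply: eq_bigr => k _.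
rewrite /codeg !mulr_sumr; apply: eq_bigr => v _; rewrite /link.
by ring.
Qed.

Lemma tri_sum_vertex a x f :
  tri_sum a x (fun i _ _ => f i) = \sum_i x i * clq 2 a (link a x i) * f i.
Proof.
apply: eq_bigr => i _; rewrite clq2_edge /edge_sum mulr_sumr mulr_suml.
apply: eq_bigr => j _; rewrite mulr_sumr mulr_suml; apply: eq_bigr => k _.
by rewrite /link; ring.
Qed.

Lemma edge_sum_vertex a x f :
  edge_sum a x (fun i _ => f i) = \sum_i x i * deg a x i * f i.
Proof.
apply: eq_bigr => i _; rewrite mulr_sumr mulr_suml.
by apply: eq_bigr => j _; ring.
Qed.

Lemma edge_sum_sub a x (f g : T -> T -> R) :
  edge_sum a x (fun i j => f i j - g i j) = edge_sum a x f - edge_sum a x g.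
Proof.
rewrite edge_sumD; congr (_ + _).
rewrite -mulN1r -edge_sumZ; congr edge_sum.
by apply/funext => i; apply/funext => j; rewrite mulN1r.
Qed.

Lemma tri_sum_sub a x f g :
  tri_sum a x (fun i j k => f i j k - g i j k) = tri_sum a x f - tri_sum a x g.
Proof.
rewrite tri_sumD; congr (_ + _); rewrite -mulN1r -tri_sumZ; congr tri_sum.
by apply/funext => i; apply/funext => j; apply/funext => k; rewrite mulN1r.
Qed.

(* [nonadj a x i j]: the weight of the vertices adjacent to neither [i] nor
   [j], when the total weight is 1. *)
Definition nonadj a x i j : R := 1 - deg a x i - deg a x j + codeg a x i j.

Lemma codegC a x i j : codeg a x i j = codeg a x j i.
Proof. by apply: eq_bigr => v _; ring. Qed.

Lemma nonadjC a x i j : nonadj a x i j = nonadj a x j i.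
Proof. by rewrite /nonadj codegC; ring. Qed.

(** The difference is the sum of [(1 - a i v) * (1 - a j v) * x v], the weight missed by both [i]
    and [j]. *)
Lemma deg_codeg_ge a x i j : weighting a -> (forall i, 0 <= x i) ->
  deg a x i + deg a x j - clq 1 a x <= codeg a x i j.
Proof.
move=> [_ _ a01] x0; rewrite clq1E -subr_ge0 /deg /codeg.
rewrite -sumrN -!big_split -sumrN -big_split; apply: sumr_ge0 => v _ /=.
have /andP[? ?] := a01 i v; have /andP[? ?] := a01 j v; have ? := x0 v.
rewrite (_ : _ - _ = (1 - a i v) * (1 - a j v) * x v); last by ring.
by rewrite !mulr_ge0 // subr_ge0.
Qed.

Lemma deg_le a x i : weighting a -> (forall i, 0 <= x i) ->
  0 <= deg a x i <= clq 1 a x.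
Proof.
move=> [_ _ a01] x0; rewrite clq1E; apply/andP; split.
  by apply: sumr_ge0 => v _; rewrite mulr_ge0 //; have /andP[] := a01 i v.
apply: ler_sum => v _; have /andP[? ?] := a01 i v.
by rewrite ler_piMl.
Qed.

Lemma codeg_le a x i j : weighting a -> (forall i, 0 <= x i) ->
  codeg a x i j <= deg a x i.
Proof.
move=> [_ _ a01] x0; apply: ler_sum => v _.
have /andP[? ?] := a01 i v; have /andP[? ?] := a01 j v.
by rewrite ler_wpM2r // ler_piMr.
Qed.

Lemma nonadj_bounds a x i j : weighting a -> (forall i, 0 <= x i) ->
  clq 1 a x = 1 -> 0 <= nonadj a x i j <= 1.
Proof.
move=> aw x0 x1; rewrite /nonadj.
have := deg_codeg_ge i j aw x0; have := codeg_le i j aw x0.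
have := deg_le j aw x0; rewrite x1 => /andP[? ?] ? ?.
by apply/andP; split; lra.
Qed.

(** Sum [deg_codeg_ge] over the edges and apply Cauchy-Schwarz to the degrees. The total weight
    stays free because the inequality is also used in links. *)
Lemma clq3_goodman a x : weighting a -> (forall i, 0 <= x i) -> 0 < clq 1 a x ->
  clq 2 a x * (2 * clq 2 a x - clq 1 a x ^+ 2) <= clq 1 a x * clq 3 a x.
Proof.
move=> aw x0 d0; have [asym _ a01] := aw.
have a0 i j : 0 <= a i j by have /andP[] := a01 i j.
set d := clq 1 a x in d0 *.
pose Q := \sum_i x i * deg a x i * deg a x i.
have H1 : 2 * Q - d * clq 2 a x <= clq 3 a x.
  rewrite clq3_edge; apply: le_trans (edge_sum_le a0 x0 (fun i j => deg_codeg_ge i j aw x0)).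
  rewrite edge_sum_sub edge_sumD (edge_sumC x (fun i _ => deg a x i) aw).
  rewrite edge_sum_vertex -/Q -/d.
  have -> : edge_sum a x (fun _ _ => d) = d * clq 2 a x.
    by rewrite clq2_edge -edge_sumZ; congr edge_sum; apply/funext => i; apply/funext => j; rewrite mulr1.
  lra.
have H2 : 0 <= d * (d * Q - clq 2 a x ^+ 2).
  have : 0 <= \sum_i x i * (d * deg a x i - clq 2 a x) ^+ 2.
    by apply: sumr_ge0 => i _; rewrite mulr_ge0 ?sqr_ge0.
  suff -> : \sum_i x i * (d * deg a x i - clq 2 a x) ^+ 2 = d * (d * Q - clq 2 a x ^+ 2) by [].
  transitivity (\sum_i (d ^+ 2 * (x i * deg a x i * deg a x i)
     + (- 2 * d * clq 2 a x) * (x i * deg a x i) + clq 2 a x ^+ 2 * x i)).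
    by apply: eq_bigr => i _; ring.
  rewrite !big_split /= -!mulr_sumr -/Q -clq2E -(clq1E a x) -/d.
  by ring.
rewrite pmulr_rge0 // subr_ge0 in H2.
have := ler_wpM2l (ltW d0) H1.
nra.
Qed.

(** Cauchy-Schwarz for the codegrees over the edges, against an upper bound on the sum [D] of their
    squares. *)
Lemma clq4_moon_moser a x : weighting a -> (forall i, 0 <= x i) ->
  clq 1 a x = 1 -> 0 < clq 2 a x ->
  3 * clq 3 a x ^+ 2 <= clq 2 a x * (clq 3 a x + 2 * clq 4 a x).
Proof.
move=> aw x0 x1 w2; have [asym _ a01] := aw.
have a0 i j : 0 <= a i j by have /andP[] := a01 i j.
pose D := tri_sum a x (fun i j _ => codeg a x i j).
have H1 : 3 * D <= clq 3 a x + 2 * clq 4 a x.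
  rewrite clq3_tri clq4_tri -tri_sumZ -tri_sumD.
  have -> : 3 * D = tri_sum a x (fun i j k => codeg a x i j + codeg a x i k + codeg a x k j).
    rewrite !tri_sumD (tri_sumC23 x (fun i j _ => codeg a x i j) aw).
    rewrite (tri_sumC12 x (fun i j k => codeg a x k i) aw).
    rewrite (tri_sumC23 x (fun i j k => codeg a x j i) aw).
    rewrite (tri_sumC12 x (fun i j k => codeg a x i j) aw) -/D.
    by ring.
  apply: tri_sum_le => // i j k.
  rewrite -[X in _ <= X + _]x1 clq1E mulr_sumr /codeg -!big_split /=.
  apply: ler_sum => v _; rewrite -subr_ge0.
  move: (a01 i v) (a01 j v) (a01 k v) (x0 v).
  move: (a i v) (a j v) (a k v) (x v) => p q r y /andP[? ?] /andP[? ?] /andP[? ?] ?.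
  (* Up to the factor [y], this is the probability that at most one of three independent events of
     probabilities [p], [q], [r] occurs. *)
  rewrite (_ : _ - _ = y * ((1 - p) * (1 - q) * (1 - r) + p * (1 - q) * (1 - r)
     + (1 - p) * q * (1 - r) + (1 - p) * (1 - q) * r)); last by ring.
  by rewrite mulr_ge0 // !addr_ge0 // !mulr_ge0 // subr_ge0.
have H2 : 0 <= clq 2 a x * (clq 2 a x * D - clq 3 a x ^+ 2).
  have : 0 <= edge_sum a x (fun i j => (clq 2 a x * codeg a x i j - clq 3 a x) ^+ 2).
    apply: sumr_ge0 => i _; apply: sumr_ge0 => j _.
    by rewrite mulr_ge0 ?sqr_ge0 // !mulr_ge0.
  suff -> : edge_sum a x (fun i j => (clq 2 a x * codeg a x i j - clq 3 a x) ^+ 2) =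
     clq 2 a x * (clq 2 a x * D - clq 3 a x ^+ 2) by [].
  transitivity (edge_sum a x (fun i j => clq 2 a x ^+ 2 * (codeg a x i j * codeg a x i j)
    + (- 2 * clq 2 a x * clq 3 a x) * codeg a x i j + clq 3 a x ^+ 2 * 1)).
    by congr edge_sum; apply/funext => i; apply/funext => j; ring.
  rewrite !edge_sumD !edge_sumZ edge_tri_sum -clq3_edge -clq2_edge -/D.
  by ring.
rewrite pmulr_rge0 // subr_ge0 in H2.
have := ler_wpM2l (ltW w2) H1; lra.
Qed.

End CliqueInequalities.

(** * Multiplier rules at a minimizer *)

Section Variations.
Context {R : realType} {T : finType}.
Implicit Types (a : T -> T -> R) (x : T -> R).

Definition simplex x : Prop := (forall i, 0 <= x i) /\ \sum_i x i = 1.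

(* Pointwise in a triangle and a vertex adjacent to its corners with weights
   p, q, r: 2 + pqr <= 3 - (p + q + r) + (pq + pr + qr), the difference being
   (1 - p)(1 - q)(1 - r).  The sum of the squared degrees cancels between the
   two hypotheses. *)
Lemma clq4_upper a x (L nu : R) : weighting a -> simplex x ->
  (forall i, x i * clq 2 a (link a x i) = x i * (2 * L * deg a x i + nu)) ->
  tri_sum a x (fun i j _ => nonadj a x i j) <= L * edge_sum a x (nonadj a x) ->
  2 * clq 3 a x + clq 4 a x <= 3 * nu * clq 2 a x + 3 * L * clq 2 a x + 3 * L * clq 3 a x.
Proof.
move=> aw [x0 x1] HV HE; have [asym _ a01] := aw.
have a0 i j : 0 <= a i j by have /andP[] := a01 i j.
pose Q := \sum_i x i * deg a x i * deg a x i.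
pose D := tri_sum a x (fun i j _ => codeg a x i j).
pose V := tri_sum a x (fun i _ _ => deg a x i).
have DE : V = 2 * L * Q + nu * clq 2 a x.
  rewrite /V tri_sum_vertex clq2E /Q !mulr_sumr -big_split; apply: eq_bigr => i _ /=.
  by rewrite HV; ring.
have E1 : tri_sum a x (fun i j _ => nonadj a x i j) = clq 3 a x - 2 * V + D.
  rewrite /nonadj tri_sumD !tri_sum_sub -clq3_tri -/D -/V.
  by rewrite (tri_sumC12 x (fun i j k => deg a x i) aw) -/V; ring.
have E2 : edge_sum a x (nonadj a x) = clq 2 a x - 2 * Q + clq 3 a x.
  rewrite /nonadj edge_sumD !edge_sum_sub -clq2_edge -clq3_edge.
  rewrite (edge_sumC x (fun i _ => deg a x i) aw) edge_sum_vertex -/Q.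
  by ring.
have E3 : 2 * clq 3 a x + clq 4 a x <= 3 * clq 3 a x - 3 * V + 3 * D.
  rewrite clq3_tri clq4_tri.
  have -> : 3 * tri_sum a x (fun _ _ _ => 1) - 3 * V + 3 * D =
    tri_sum a x (fun i j k => 3 * 1 - (deg a x i + deg a x j + deg a x k)
        + (codeg a x i j + codeg a x i k + codeg a x k j)).
    rewrite tri_sumD tri_sum_sub tri_sumZ !tri_sumD.
    rewrite (tri_sumC23 x (fun i j _ => codeg a x i j) aw).
    rewrite (tri_sumC12 x (fun i j k => codeg a x k i) aw).
    rewrite (tri_sumC23 x (fun i j k => codeg a x j i) aw).
    rewrite (tri_sumC12 x (fun i j k => codeg a x i j) aw) -/D.
    rewrite (tri_sumC23 x (fun i j k => deg a x j) aw).
    by rewrite (tri_sumC12 x (fun i j k => deg a x i) aw) -/V; ring.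
  rewrite -tri_sumZ -tri_sumD; apply: tri_sum_le => // i j k.
  rewrite -[X in 2 * X]x1 -[X in 3 * X]x1.
  rewrite /codeg /deg !mulr_sumr -!big_split -sumrN -!big_split /=.
  apply: ler_sum => v _; rewrite -subr_ge0.
  move: (a01 i v) (a01 j v) (a01 k v) (x0 v).
  move: (a i v) (a j v) (a k v) (x v) => p q r y /andP[? ?] /andP[? ?] /andP[? ?] ?.
  rewrite (_ : _ - _ = y * ((1 - p) * (1 - q) * (1 - r))); last by ring.
  by rewrite mulr_ge0 // !mulr_ge0 // subr_ge0.
rewrite E1 E2 in HE.
lra.
Qed.

(** Second-order companion of Bernoulli's inequality; it makes the errors of the perturbations below
    quadratic in [t]. *)
Lemma onem_expr_le (r : nat) (t : R) : 0 <= t <= 1 ->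
  (1 - t) ^+ r <= 1 - r%:R * t + r%:R ^+ 2 * t ^+ 2.
Proof.
move=> /andP[t0 t1]; elim: r => [|r IHr]; first by rewrite expr0; lra.
rewrite exprS; apply: le_trans (ler_wpM2l _ IHr) _; first by rewrite subr_ge0.
rewrite -(natr1 r); have r0 : 0 <= r%:R :> R by [].
have : 0 <= r%:R * t ^+ 2 by rewrite mulr_ge0 // sqr_ge0.
have : 0 <= r%:R ^+ 2 * t ^+ 3 by rewrite mulr_ge0 ?exprn_ge0.
have : 0 <= t ^+ 2 by rewrite sqr_ge0.
nra.
Qed.

(* A one-sided Lagrange multiplier rule: [t] is the size of a feasible
   perturbation, [h] the displacement of the parameter [p]. *)
Lemma first_order (lo hi p c1 lam B M D L : R) :
  lo < p -> p < hi -> c1 < 0 -> 0 <= lam -> 0 <= B -> 0 <= M ->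
  (forall t h, 0 <= t <= 1 -> lo <= p + h <= hi ->
     c1 * h <= D * t - M * t ^+ 2 ->
     0 <= L * t + M * t ^+ 2 - lam * c1 * h + B * h ^+ 2) ->
  lam * D <= L.
Proof.
move=> lop phi c10 lam0 B0 M0 H; rewrite leNgt; apply/negP => gap.
pose g := lam * D - L.
have g0 : 0 < g by rewrite subr_gt0.
have l1 : 0 < 2 * (lam + 1) by lra.
pose e := g / (2 * (lam + 1)).
have e0 : 0 < e by rewrite divr_gt0.
have ge : g = e * (2 * (lam + 1)) by rewrite /e mulfVK // gt_eqF.
(* The displacement [h = al * t] uses the constraint up to [e * t], which leaves room for the
   quadratic terms once [t] is small. *)
pose al := (D - e) / c1.
have ale : c1 * al = D - e by rewrite mulrC mulfVK // lt_eqF.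
have A0 : 0 < `|al| + 1 by rewrite ltr_wpDl.
have N0 : 0 < M + B * al ^+ 2 + 1.
  by rewrite ltr_wpDl // addr_ge0 // mulr_ge0 // sqr_ge0.
have M1 : 0 < M + 1 by lra.
(* The five bounds keep [t] in range, pay for [M * t ^+ 2] in the constraint, keep [p + al * t] in
   the interval on both sides, and pay for the quadratic terms of the objective. *)
pose t := Num.min 1 (Num.min (e / (M + 1)) (Num.min ((p - lo) / (`|al| + 1))
  (Num.min ((hi - p) / (`|al| + 1)) (e / (M + B * al ^+ 2 + 1))))).
have t0 : 0 < t by rewrite !lt_min ltr01 !divr_gt0 // subr_gt0.
have [t1 t2 t3 t4 t5] : [/\ t <= 1, t * (M + 1) <= e, t * (`|al| + 1) <= p - lo,
   t * (`|al| + 1) <= hi - p & t * (M + B * al ^+ 2 + 1) <= e].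
  by rewrite -!ler_pdivlMr //; split; rewrite /t !ge_min lexx ?orbT.
have talle : `|al * t| <= t * (`|al| + 1).
  by rewrite normrM (gtr0_norm t0) mulrC ler_pM2l // lerDl.
move: talle; rewrite ler_norml => /andP[al1 al2].
have := H t (al * t); rewrite t1 (ltW t0).
have -> : lo <= p + al * t <= hi by apply/andP; split; lra.
have -> : c1 * (al * t) <= D * t - M * t ^+ 2.
  rewrite mulrA ale; have := ler_wpM2l (ltW t0) t2; nra.
move=> /(_ isT isT isT).
rewrite (_ : _ + _ = t * ((t * (M + B * al ^+ 2 + 1) - e) + (L - lam * (c1 * al) - t + e))); last by ring.
rewrite pmulr_rge0 // ale.
have -> : L = lam * D - e * (2 * (lam + 1)) by rewrite -ge /g; ring.
have : 0 <= lam * e by rewrite mulr_ge0 // ltW.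
nra.
Qed.

End Variations.

Section Minimizers.
Context {R : realType} {T : finType}.
Implicit Types (a : T -> T -> R) (x : T -> R) (m p k lam : R) (f : R -> R).

(* [c2 m p] is the value of [clq 2] at the complete graph with [m] vertices of
   weight [p] and one of weight [1 - m p]. *)
Definition c2 m p : R := 2 * m * p - m * (m + 1) * p ^+ 2.

Definition feasible m a x p : Prop :=
  [/\ weighting a, simplex x, (m + 1)^-1 <= p <= m^-1 & c2 m p <= clq 2 a x].

(** The parameter [p] varies together with [a] and [x]. For positive [f], a minimizer of the ratio
    [clq r / f] fits this form with [k] the minimal ratio. *)
Definition minimizer m r k f a x p : Prop :=
  feasible m a x p /\
  forall a' x' p', feasible m a' x' p' ->
    clq r a x - k * f p <= clq r a' x' - k * f p'.

(* [lam] is the derivative of [f] with respect to [c2 m] at [p]. *)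
Definition multiplier m f lam p : Prop :=
  exists2 B, 0 <= B & forall h, (m + 1)^-1 <= p + h <= m^-1 ->
    f p + lam * (2 * m * (1 - (m + 1) * p)) * h - B * h ^+ 2 <= f (p + h).

(** [D] bounds the first-order change of [clq 2] from below, [L] that of [clq r] from above. Since
    [c2 m] is concave, it lies below its tangent at [p], so a displacement allowed by the tangent is
    feasible. *)
Lemma minimizer_variation m r k f lam a x p (at_ : R -> T -> T -> R)
    (xt : R -> T -> R) (D L M : R) :
  0 < m -> 0 <= k -> 0 <= lam -> (m + 1)^-1 < p -> p < m^-1 ->
  minimizer m r k f a x p -> multiplier m f lam p -> 0 <= M ->
  (forall t, 0 <= t <= 1 -> [/\ weighting (at_ t), simplex (xt t),
     c2 m p + D * t - M * t ^+ 2 <= clq 2 (at_ t) (xt t) &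
     clq r (at_ t) (xt t) <= clq r a x + L * t + M * t ^+ 2]) ->
  k * lam * D <= L.
Proof.
move=> m0 k0 lam0 lop phi [_ Hmin] [B B0 HB] M0 H.
have m1 : 0 < m + 1 by lra.
have c10 : 2 * m * (1 - (m + 1) * p) < 0.
  rewrite pmulr_rlt0; last by lra.
  by rewrite subr_lt0 -ltr_pdivrMl // mulr1.
apply: (first_order (B := k * B) lop phi c10 _ _ M0).
- exact: mulr_ge0.
- exact: mulr_ge0.
move=> t h t01 ph Hh; have [aw xs H2 Hr] := H t t01.
have fe : feasible m (at_ t) (xt t) (p + h).
  split=> //; apply: le_trans H2.
  have : 0 <= m * (m + 1) * h ^+ 2 by rewrite mulr_ge0 ?sqr_ge0 // mulr_ge0 // ltW.
  rewrite /c2; nra.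
have := Hmin _ _ _ fe; have := ler_wpM2l k0 (HB h ph).
lra.
Qed.

Section AtMinimizer.
Context (m k lam p : R) (f : R -> R) (r : nat) (a : T -> T -> R) (x : T -> R)
  (m0 : 0 < m) (k0 : 0 < k) (lam0 : 0 < lam) (lop : (m + 1)^-1 < p)
  (phi : p < m^-1) (Hmin : minimizer m r.+1 k f a x p)
  (Hmul : multiplier m f lam p).

Let aw : weighting a. Proof. by case: Hmin => [] []. Qed.
Let xs : simplex x. Proof. by case: Hmin => [] []. Qed.
Let a0 i j : 0 <= a i j. Proof. by case: aw => _ _ /(_ i j)/andP[]. Qed.
Let x0 i : 0 <= x i. Proof. by case: xs. Qed.
Let W_0 q y : (forall i, 0 <= y i) -> 0 <= clq q a y.
Proof. exact: clq_ge0. Qed.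
Let link0 i j : 0 <= link a x i j. Proof. exact: mulr_ge0. Qed.

(** Slack in the edge condition would allow [p] to move alone: the path is constant in [a] and [x],
    and the whole slack serves as [D]. *)
Lemma minimizer_clq2 : clq 2 a x = c2 m p.
Proof.
have fe : c2 m p <= clq 2 a x by case: Hmin => [] [].
apply/eqP; rewrite eq_le fe andbT.
suff : k * lam * (clq 2 a x - c2 m p) <= 0.
  by rewrite pmulr_rle0 ?mulr_gt0 // subr_le0.
apply: (minimizer_variation (at_ := fun=> a) (xt := fun=> x) m0 (ltW k0) (ltW lam0) lop phi Hmin Hmul (lexx 0)).
move=> t /andP[t0 t1]; split=> //; last by rewrite !mul0r !addr0.
have : 0 <= (1 - t) * (clq 2 a x - c2 m p) by rewrite mulr_ge0 // subr_ge0.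
lra.
Qed.

(** Derivative along the segment from [x] to the point mass at [i], where [clq_shift] makes the
    clique sums explicit. *)
Lemma minimizer_vertex i :
  k * lam * (2 * deg a x i - 2 * clq 2 a x) <=
  r.+1%:R * (clq r a (link a x i) - clq r.+1 a x).
Proof.
pose M := 2 * deg a x i + r.+1%:R ^+ 2 * clq r.+1 a x.
have d0 : 0 <= deg a x i by have /andP[] := deg_le i aw x0.
have W00 := W_0 r.+1 x0.
have M0 : 0 <= M by rewrite addr_ge0 ?mulr_ge0 // sqr_ge0.
apply: (minimizer_variation (at_ := fun=> a)
  (xt := fun t j => (1 - t) * x j + t * (j == i)%:R)
  m0 (ltW k0) (ltW lam0) lop phi Hmin Hmul M0).
move=> t /andP[t0 t1]; split=> //.
- split=> [j|]; first by rewrite addr_ge0 // mulr_ge0 // subr_ge0.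
  rewrite big_split /= -!mulr_sumr xs.2 (bigD1 i) //= eqxx big1 ?addr0 /=; first by ring.
  by move=> j /negPf ->.
- rewrite (clq_shift 1) // -minimizer_clq2 clq1_link.
  have ? := W_0 2 x0; have : 0 <= t ^+ 2 * clq 2 a x by rewrite mulr_ge0 ?sqr_ge0.
  have : 0 <= t ^+ 2 * (r.+1%:R ^+ 2 * clq r.+1 a x).
    by rewrite !mulr_ge0 ?sqr_ge0.
  rewrite /M; lra.
- rewrite clq_shift //.
  have := ler_wpM2r W00 (onem_expr_le r.+1 (introT andP (conj t0 t1))).
  have K0 := W_0 r (link0 i).
  have p1 : (1 - t) ^+ r <= 1 by rewrite exprn_ile1 ?subr_ge0 // gerBl.
  have : r.+1%:R * t * (1 - t) ^+ r * clq r a (link a x i) <= r.+1%:R * t * clq r a (link a x i).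
    by rewrite -mulrA ler_wpM2l ?mulr_ge0 // ler_piMl.
  have : 0 <= t ^+ 2 * deg a x i by rewrite mulr_ge0 ?sqr_ge0.
  rewrite /M; lra.
Qed.

(* The inequalities of [minimizer_vertex] average to an equality. *)
Lemma minimizer_vertex_eq i :
  x i * (r.+1%:R * clq r a (link a x i)) =
  x i * (2 * k * lam * (deg a x i - clq 2 a x) + r.+1%:R * clq r.+1 a x).
Proof.
pose F j := x j * (r.+1%:R * (clq r a (link a x j) - clq r.+1 a x)
  - k * lam * (2 * deg a x j - 2 * clq 2 a x)).
have F0 j : 0 <= F j by rewrite mulr_ge0 // subr_ge0 minimizer_vertex.
have : \sum_j F j = 0.
  transitivity (\sum_j (r.+1%:R * (x j * clq r a (link a x j)) - 2 * k * lam * (x j * deg a x j)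
     + (2 * k * lam * clq 2 a x - r.+1%:R * clq r.+1 a x) * x j)).
    by apply: eq_bigr => j _; rewrite /F; ring.
  rewrite !big_split /= sumrN -!mulr_sumr -clqS -clq2E xs.2; ring.
move/eqP; rewrite psumr_eq0 // => /allP /(_ i (mem_index_enum _)) /eqP.
by rewrite /F; lra.
Qed.

(* All edges at [i] are scaled by [1 - t]. *)
Lemma minimizer_star i :
  r.+1%:R * r%:R * (x i * clq r a (link a x i)) <= 2 * k * lam * (x i * deg a x i).
Proof.
have K0 := W_0 r (link0 i).
pose y := x i * clq r a (link a x i).
have y0 : 0 <= y by rewrite mulr_ge0.
pose M := r.+1%:R * r%:R ^+ 2 * y.
have M0 : 0 <= M by rewrite !mulr_ge0 // sqr_ge0.
pose s t (j : T) : R := 1 - t * (j == i)%:R.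
have sE q t : (fun j => s t j ^+ q * x j) =
   (fun j => 1 * x j + ((1 - t) ^+ q - 1) * x i * (j == i)%:R).
  apply/funext => j; rewrite /s; case: eqP => [->|_]; first by rewrite !mulr1; ring.
  by rewrite !mulr0 subr0 expr1n addr0.
(* A clique on [q.+1] vertices through [i] has [q] pairs at [i], hence is scaled by
   [(1 - t) ^+ q]. *)
have WE q t : clq q.+1 (fun u v => a u v * (s t u * s t v)) x =
    clq q.+1 a x - q.+1%:R * (1 - (1 - t) ^+ q) * (x i * clq q a (link a x i)).
  by rewrite clq_vertex_factors sE clq_shift // !expr1n; ring.
suff : k * lam * (- 2 * (x i * deg a x i)) <= - (r.+1%:R * r%:R * y).
  rewrite -/y; lra.
apply: (minimizer_variation (at_ := fun t u v => a u v * (s t u * s t v))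
  (xt := fun=> x) m0 (ltW k0) (ltW lam0) lop phi Hmin Hmul M0).
move=> t /andP[t0 t1]; split=> //.
- have [asym aii a01] := aw.
  have s01 j : 0 <= s t j <= 1.
    by rewrite /s; case: eqP => _; rewrite ?mulr1 ?mulr0; apply/andP; split; lra.
  split=> [u v|u|u v]; first by rewrite asym; ring.
    by rewrite aii mul0r.
  have /andP[? ?] := s01 u; have /andP[? ?] := s01 v; have /andP[? ?] := a01 u v.
  by rewrite !mulr_ge0 //= !mulr_ile1 // mulr_ge0.
- rewrite WE -minimizer_clq2 clq1_link expr1.
  have : 0 <= M * t ^+ 2 by rewrite mulr_ge0 // sqr_ge0.
  lra.
- rewrite WE -/y.
  have := ler_wpM2r (mulr_ge0 (ler0n R r.+1) y0) (onem_expr_le r (introT andP (conj t0 t1))).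
  by rewrite /M; lra.
Qed.

End AtMinimizer.

(** Scaling each entry by [1 - t * b] costs a triangle, to first order, the sum of [b] over its
    three sides; by symmetry the sides contribute equally. *)
Lemma minimizer_edge m k lam p f a x (b : T -> T -> R) :
  0 < m -> 0 < k -> 0 < lam -> (m + 1)^-1 < p -> p < m^-1 ->
  minimizer m 3 k f a x p -> multiplier m f lam p ->
  (forall i j, b i j = b j i) -> (forall i j, 0 <= b i j <= 1) ->
  3 * tri_sum a x (fun i j _ => b i j) <= k * lam * edge_sum a x b.
Proof.
move=> m0 k0 lam0 lop phi Hmin Hmul bsym b01.
have W2eq := minimizer_clq2 m0 k0 lam0 lop phi Hmin Hmul.
have [[aw xs _ _] _] := Hmin; have [asym aii a01] := aw; have [x0 _] := xs.
have a0 i j : 0 <= a i j by have /andP[] := a01 i j.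
have M0 : 0 <= 3 * clq 3 a x by rewrite mulr_ge0 // clq_ge0.
suff : k * lam * - edge_sum a x b <= - (3 * tri_sum a x (fun i j _ => b i j)) by lra.
apply: (minimizer_variation (at_ := fun t u v => a u v * (1 - t * b u v))
  (xt := fun=> x) m0 (ltW k0) (ltW lam0) lop phi Hmin Hmul M0).
move=> t /andP[t0 t1].
have tb u v : 0 <= t * b u v <= 1.
  have /andP[? ?] := b01 u v; by rewrite mulr_ge0 //= mulr_ile1.
split=> //.
- split=> [u v|u|u v]; first by rewrite asym bsym.
    by rewrite aii mul0r.
  have /andP[? ?] := a01 u v; have /andP[? ?] := tb u v.
  by rewrite mulr_ge0 ?subr_ge0 //= mulr_ile1 ?subr_ge0 // gerBl.
- have -> : clq 2 (fun u v => a u v * (1 - t * b u v)) x = clq 2 a x - t * edge_sum a x b.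
    rewrite !clq2_edge -edge_sumZ -edge_sum_sub; apply: eq_bigr => i _.
    by apply: eq_bigr => j _; ring.
  rewrite -W2eq; have : 0 <= 3 * clq 3 a x * t ^+ 2 by rewrite mulr_ge0 // sqr_ge0.
  lra.
- have -> : clq 3 (fun u v => a u v * (1 - t * b u v)) x =
    tri_sum a x (fun i j l => (1 - t * b i j) * (1 - t * b i l) * (1 - t * b j l)).
    rewrite clq3_tri; apply: eq_bigr => i _; apply: eq_bigr => j _.
    by apply: eq_bigr => l _; ring.
  have -> : clq 3 a x + - (3 * tri_sum a x (fun i j _ => b i j)) * t + 3 * clq 3 a x * t ^+ 2 =
    tri_sum a x (fun i j l => (1 + 3 * t ^+ 2) * 1 - t * (b i j + b i l + b l j)).
    rewrite tri_sum_sub !tri_sumZ !tri_sumD.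
    rewrite (tri_sumC23 x (fun i j _ => b i j) aw).
    rewrite (tri_sumC12 x (fun i j l => b l i) aw).
    rewrite (tri_sumC23 x (fun i j l => b j i) aw).
    by rewrite (tri_sumC12 x (fun i j l => b i j) aw) -clq3_tri; ring.
  apply: tri_sum_le => // i j l; rewrite (bsym l j).
  move: (b01 i j) (b01 i l) (b01 j l); move: (b i j) (b i l) (b j l) => p1 p2 p3.
  move=> /andP[? ?] /andP[? ?] /andP[? ?].
  have q12 : p1 * p2 <= 1 by rewrite mulr_ile1.
  have q13 : p1 * p3 <= 1 by rewrite mulr_ile1.
  have q23 : p2 * p3 <= 1 by rewrite mulr_ile1.
  have T2 : 0 <= t ^+ 2 by rewrite sqr_ge0.
  have : 0 <= t ^+ 3 * (p1 * p2 * p3) by rewrite mulr_ge0 ?exprn_ge0 ?mulr_ge0.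
  have := ler_wpM2l T2 q12; have := ler_wpM2l T2 q13; have := ler_wpM2l T2 q23.
  lra.
Qed.

End Minimizers.

(** * Existence of minimizers *)

Section Existence.
Local Open Scope classical_set_scope.
Local Open Scope ring_scope.

Lemma continuous_sumr (R : realType) (V : topologicalType) (I : finType)
    (F : I -> V -> R) :
  (forall i, continuous (F i)) -> continuous (fun v => \sum_i F i v).
Proof. by move=> cF; apply: continuous_big => //; exact: add_continuous. Qed.

Lemma continuous_addr (R : realType) (V : topologicalType) (f g : V -> R) :
  continuous f -> continuous g -> continuous (fun v => f v + g v).
Proof. by move=> cf cg v; apply: cvgD; [exact: cf|exact: cg]. Qed.

Lemma continuous_subr (R : realType) (V : topologicalType) (f g : V -> R) :
  continuous f -> continuous g -> continuous (fun v => f v - g v).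
Proof. by move=> cf cg v; apply: cvgB; [exact: cf|exact: cg]. Qed.

Lemma continuous_mulr (R : realType) (V : topologicalType) (f g : V -> R) :
  continuous f -> continuous g -> continuous (fun v => f v * g v).
Proof. by move=> cf cg v; apply: cvgM; [exact: cf|exact: cg]. Qed.

Lemma continuous_W (R : realType) (T : finType) (V : topologicalType) r
    (a : V -> T -> T -> R) (x : V -> T -> R) :
  (forall i j, continuous (fun v => a v i j)) ->
  (forall i, continuous (fun v => x v i)) ->
  continuous (fun v => clq r (a v) (x v)).
Proof.
move=> ca; elim: r x => [|r IHr] x cx.
  exact: cst_continuous.
apply: (@continuous_sumr _ _ _ (fun i v => x v i * clq r (a v) (link (a v) (x v) i))) => i.
apply: continuous_mulr => //; apply: (IHr (fun v => link (a v) (x v) i)) => j.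
exact: continuous_mulr.
Qed.

(** Compactness of the feasible set. The factor [g] and the term [h] cover both differences and
    ratios; [g] is continuous on the interval only, so that it may be the inverse of [f3]. *)
Lemma exists_minimum (R : realType) (T : finType) (m : R) r (g h : R -> R) a0 x0 p0 :
  (forall p, (m + 1)^-1 <= p <= m^-1 -> {for p, continuous g}) ->
  continuous h -> @feasible R T m a0 x0 p0 ->
  exists (a : T -> T -> R) (x : T -> R) p, feasible m a x p /\
    forall (a' : T -> T -> R) (x' : T -> R) p', feasible m a' x' p' ->
    clq r a x * g p - h p <= clq r a' x' * g p' - h p'.
Proof.
move=> cg ch fe0.
(* A triple of [a], [x], [p] is coded as one row vector, so that feasibility becomes a closed
   condition inside a product of segments. *)
pose I : finType := ((T * T) + (T + unit))%type.
pose V := 'rV[R]_#|I|.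
pose c (i : I) (u : V) : R := u ord0 (enum_rank i).
have cc i : continuous (c i) by exact: coord_continuous.
pose a_ (u : V) i j := c (inl (i, j)) u.
pose x_ (u : V) i := c (inr (inl i)) u.
pose p_ (u : V) := c (inr (inr tt)) u.
pose enc (a : T -> T -> R) (x : T -> R) (p : R) : V := \row_k
  match enum_val k with inl (i, j) => a i j | inr (inl i) => x i | _ => p end.
have aK a x p : a_ (enc a x p) = a.
  by apply/funext => i; apply/funext => j; rewrite /a_ /c mxE enum_rankK.
have xK a x p : x_ (enc a x p) = x.
  by apply/funext => i; rewrite /x_ /c mxE enum_rankK.
have pK a x p : p_ (enc a x p) = p.
  by rewrite /p_ /c mxE enum_rankK.
pose box (k : 'I_#|I|) : set R :=
  if enum_val k is inr (inr _) then `[(m + 1)^-1, m^-1]%classic else `[0, 1]%classic.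
pose B : set V := [set u | forall k, box k (u ord0 k)].
have cB : compact B.
  by apply: rV_compact => k; rewrite /box; case: (enum_val k) => [?|[?|?]] /=; apply: segment_compact.
(* As [E] is a sum of squares, [E u <= 0] says at once that the matrix is symmetric with zero
   diagonal and that the weights add up to 1. *)
pose E (u : V) : R := \sum_i \sum_j (a_ u i j - a_ u j i) * (a_ u i j - a_ u j i)
  + \sum_i a_ u i i * a_ u i i + (\sum_i x_ u i - 1) * (\sum_i x_ u i - 1).
pose G (u : V) : R := clq 2 (a_ u) (x_ u) - c2 m (p_ u).
have cE : continuous E.
  have cst1 : continuous (fun _ : V => 1 : R) by exact: cst_continuous.
  have cS := continuous_subr (continuous_sumr (fun i : T => cc (inr (inl i)))) cst1.
  apply: continuous_addr; last exact: continuous_mulr.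
  apply: continuous_addr; last by apply: continuous_sumr => i; apply: continuous_mulr; apply: cc.
  apply: continuous_sumr => i; apply: continuous_sumr => j.
  by apply: continuous_mulr; apply: continuous_subr; apply: cc.
have cG : continuous G.
  apply: continuous_subr; first by apply: continuous_W => *; apply: cc.
  have cst k : continuous (fun _ : V => k : R) by exact: cst_continuous.
  by apply: continuous_subr; do ?[apply: continuous_mulr => //]; apply: cc.
pose S : set V := B `&` (E @^-1` [set y | y <= 0] `&` G @^-1` [set y | 0 <= y]).
have cS : compact S.
  apply: compact_closedI => //; apply: closedI.
    by apply: preimage_closed; [move=> u _; exact: cE|exact: closed_le].
  by apply: preimage_closed; [move=> u _; exact: cG|exact: closed_ge].
have SP u : S u <-> feasible m (a_ u) (x_ u) (p_ u).
  split.
    case=> Bu [/= Eu Gu].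
    have Bc i : box (enum_rank i) (c i u) by exact: Bu.
    have a01 i j : 0 <= a_ u i j <= 1.
      by have := Bc (inl (i, j)); rewrite /box enum_rankK /= in_itv.
    have x01 i : 0 <= x_ u i <= 1.
      by have := Bc (inr (inl i)); rewrite /box enum_rankK /= in_itv.
    have p01 : (m + 1)^-1 <= p_ u <= m^-1.
      by have := Bc (inr (inr tt)); rewrite /box enum_rankK /= in_itv.
    have sq (y : R) : 0 <= y * y by rewrite -expr2 sqr_ge0.
    have sq0 (y : R) : y * y <= 0 -> y = 0.
      by move=> y0; apply/eqP; rewrite -[_ == _]orbb -mulf_eq0 eq_le y0 sq.
    have E2 : 0 <= \sum_i a_ u i i * a_ u i i by apply: sumr_ge0.
    have E1 : 0 <= \sum_i \sum_j (a_ u i j - a_ u j i) * (a_ u i j - a_ u j i).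
      by apply: sumr_ge0 => i _; apply: sumr_ge0.
    have E3 := sq (\sum_i x_ u i - 1).
    split=> //; last by rewrite -subr_ge0.
    - split=> // [i j|i].
        apply/eqP; rewrite -subr_eq0; apply/eqP/sq0.
        apply: le_trans (_ : E u <= 0) => //.
        rewrite /E -addrA; apply: ler_wpDr; first exact: addr_ge0.
        rewrite (bigD1 i) //=; apply: ler_wpDr; first by apply: sumr_ge0 => *; apply: sumr_ge0.
        by rewrite (bigD1 j) //=; apply: ler_wpDr => //; apply: sumr_ge0.
      apply: sq0; apply: le_trans (_ : E u <= 0) => //.
      rewrite /E -addrA; apply: ler_wpDl => //; apply: ler_wpDr => //.
      by rewrite (bigD1 i) //=; apply: ler_wpDr => //; apply: sumr_ge0.
    - split=> [i|]; first by have /andP[] := x01 i.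
      apply/eqP; rewrite -subr_eq0; apply/eqP/sq0.
      by apply: le_trans (_ : E u <= 0) => //; rewrite /E ler_wpDl // addr_ge0.
  move=> [[asym aii a01] [x0' x1] p01 H2]; split.
    move=> k; have -> : u ord0 k = c (enum_val k) u by rewrite /c enum_valK.
    rewrite /box; case: (enum_val k) => [[i j]|[i|[]]] /=; rewrite in_itv //=; first exact: a01.
    rewrite x0' -x1 (bigD1 i) //=; apply: ler_wpDr => //.
    exact: sumr_ge0.
  split; last by rewrite /= subr_ge0.
  rewrite /= /E x1 subrr mulr0 addr0 big1 ?add0r ?big1 // => [i _|i _].
    by rewrite aii mulr0.
  by rewrite big1 // => j _; rewrite asym subrr mulr0.
have fenc a x p : feasible m a x p -> S (enc a x p) by move=> fe; apply/SP; rewrite aK xK pK.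
have S0 : S !=set0 by exists (enc a0 x0 p0); exact: fenc.
pose O (u : V) : R := clq r (a_ u) (x_ u) * g (p_ u) - h (p_ u).
have cO : {within S, continuous O}.
  apply: continuous_in_subspaceT => u /set_mem/SP[_ _ pu _].
  have cW : {for u, continuous (fun u => clq r (a_ u) (x_ u))}.
    by apply: continuous_W => *; apply: cc.
  have cgp : {for u, continuous (g \o p_)}.
    by apply: continuous_comp; [exact: cc|exact: cg].
  have chp : {for u, continuous (h \o p_)}.
    by apply: continuous_comp; [exact: cc|exact: ch].
  exact: (continuousB (continuousM cW cgp) chp).
have [u Su Hu] := compact_EVT_min S0 cS cO.
rewrite inE in Su; exists (a_ u), (x_ u), (p_ u); split; first exact/SP.
move=> a x p /fenc fe; have := Hu (enc a x p); rewrite inE => /(_ fe).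
by rewrite /O aK xK pK.
Qed.

End Existence.

(** * Real inequalities *)

Section RealInequalities.
Context {R : realType}.
Implicit Types (m M p d z w th E F : R).

(* [r! L_r] of the complete graph with [m] vertices of weight [p] and one of
   weight [1 - m p], for r = 3, 4. *)
Definition f3 m p : R :=
  3 * m * (m - 1) * p ^+ 2 - 2 * (m + 1) * m * (m - 1) * p ^+ 3.

Definition f4 m p : R :=
  4 * m * (m - 1) * (m - 2) * p ^+ 3
  - 3 * (m + 1) * m * (m - 1) * (m - 2) * p ^+ 4.

Lemma range_bounds m p : 1 <= m -> (m + 1)^-1 <= p <= m^-1 ->
  [/\ 0 < p, p <= 1, m * p <= 1 & 1 <= (m + 1) * p].
Proof.
move=> m1 /andP[lo hi]; have m0 : 0 < m by lra.
have mp : 0 < m + 1 by lra.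
have p0 : 0 < p by apply: lt_le_trans lo; rewrite invr_gt0.
split=> //.
- by apply: le_trans hi _; rewrite invf_le1.
- by rewrite -ler_pdivlMl // mulr1.
- by rewrite -ler_pdivrMl // mulr1.
Qed.

(** The value is the quotient of the derivatives of [f3 m] and [c2 m], in which [1 - (m + 1) * p]
    cancels. The constant [B] dominates the remainder on the interval. *)
Lemma multiplier_f3 m p : 1 <= m -> (m + 1)^-1 <= p <= m^-1 ->
  multiplier m (f3 m) (3 * (m - 1) * p) p.
Proof.
move=> m1 pr; have [p0 p1 _ _] := range_bounds m1 pr.
have m10 : 0 <= m - 1 by lra.
have m0 : 0 <= m by lra.
have mp : 0 <= m + 1 by lra.
exists (8 * (m + 1) * (m * (m - 1))); first by rewrite !mulr_ge0.
move=> h ph; have [q0 q1 _ _] := range_bounds m1 ph.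
rewrite -subr_ge0 (_ : _ - _ = m * (m - 1) * h ^+ 2 *
  (3 + (m + 1) * (8 - 4 * p - 2 * (p + h)))); last by rewrite /f3; ring.
apply: mulr_ge0; first exact: mulr_ge0 (mulr_ge0 m0 m10) (sqr_ge0 h).
by apply: addr_ge0 => //; apply: mulr_ge0 => //; lra.
Qed.

Lemma multiplier_f4 m p : 2 <= m -> (m + 1)^-1 <= p <= m^-1 ->
  multiplier m (f4 m) (6 * (m - 1) * (m - 2) * p ^+ 2) p.
Proof.
move=> m2 pr; have m1 : 1 <= m by lra.
have [p0 p1 _ _] := range_bounds m1 pr.
have m10 : 0 <= m - 1 by lra.
have m20 : 0 <= m - 2 by lra.
have m0 : 0 <= m by lra.
have mp : 0 <= m + 1 by lra.
exists (18 * (m + 1) * (m * (m - 1) * (m - 2))); first by rewrite !mulr_ge0.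
move=> h ph; have [q0 q1 _ _] := range_bounds m1 ph.
set q := p + h in q0 q1 *.
have -> : h = q - p by rewrite /q; ring.
rewrite -subr_ge0 (_ : _ - _ = m * (m - 1) * (m - 2) * (q - p) ^+ 2 *
  (8 * p + 4 * q + 3 * (m + 1) * ((1 - q ^+ 2) + 2 * (1 - p * q) + 3 * (1 - p ^+ 2)))); last first.
  by rewrite /f4; ring.
have q2 : q ^+ 2 <= 1 by rewrite exprn_ile1 // ltW.
have p2 : p ^+ 2 <= 1 by rewrite exprn_ile1 // ltW.
have pq : p * q <= 1 by rewrite mulr_ile1 // ltW.
apply: mulr_ge0; first exact: mulr_ge0 (mulr_ge0 (mulr_ge0 m0 m10) m20) (sqr_ge0 _).
have : 0 <= 3 * (m + 1) * ((1 - q ^+ 2) + 2 * (1 - p * q) + 3 * (1 - p ^+ 2)).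
  by apply: mulr_ge0; [exact: mulr_ge0|lra].
lra.
Qed.

(* [clq 2] and [clq 3] of the complete graph with [M] vertices of weight [q] and
   total weight [d]. *)
Definition g2 M d q : R := 2 * M * q * d - M * (M + 1) * q ^+ 2.

Definition g3 M d q : R :=
  3 * M * (M - 1) * q ^+ 2 * d - 2 * (M + 1) * M * (M - 1) * q ^+ 3.

(** The defect of Goodman's inequality at [q = 1]. It vanishes at [d = M] and [d = M + 1], where all
    parts of positive weight are equal, and changes sign at [d = M]. *)
Lemma goodman_gap M d :
  g2 M d 1 * (2 * g2 M d 1 - d ^+ 2) - d * g3 M d 1 =
  - (2 * M * (d - M) * (1 - (d - M)) ^+ 2).
Proof. by rewrite /g2 /g3; ring. Qed.

(** Intermediate value theorem for [g2 M d] on [[1, d / M]]. The bounds on [E] are the values at the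
    ends; at [d / M] the graph has [M] equal parts. *)
Lemma link_reparam M d E : 1 <= M -> M <= d -> d <= M + 1 ->
  (M - 1) * d ^+ 2 <= M * E -> E < g2 M d 1 ->
  exists q, [/\ 1 < q, M * q <= d & E = g2 M d q].
Proof.
rewrite /g2 => M1 Md dM El Eu; have M0 : 0 < M by lra.
pose g : {poly R} := (M * (M + 1))%:P * 'X^2 - (2 * M * d)%:P * 'X + E%:P.
have gE q : g.[q] = M * (M + 1) * q ^+ 2 - 2 * M * d * q + E by rewrite /g !hornerE.
have dM1 : 1 <= d / M by rewrite ler_pdivlMr // mul1r.
have [|q /andP[q1 qd] /rootP] := @poly_ivt _ g 1 (d / M) dM1.
  rewrite !gE; apply/andP; split; first by lra.
  have -> : M * (M + 1) * (d / M) ^+ 2 - 2 * M * d * (d / M) + E =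
     (M * E - (M - 1) * d ^+ 2) / M by field; rewrite gt_eqF.
  by rewrite divr_ge0 ?subr_ge0 // ltW.
rewrite gE => q0; exists q; split; last by lra.
- rewrite lt_neqAle q1 andbT; apply/eqP => qe; move: q0; rewrite -qe; lra.
- by rewrite mulrC -ler_pdivlMr.
Qed.

(** The last case of [link_gap], multiplied by [g2 M d 1]: there [E = g2 M d q],
    [th = E / g2 M d 1], and the triangle bound provides [g3 M d q]. *)
Lemma g3_concave_gap M d q : 2 <= M -> M < d -> d <= M + 1 -> 1 < q ->
  M * q <= d ->
  g2 M d q * g3 M d 1 - 3 * M * g2 M d q * (g2 M d 1 - g2 M d q)
  < g2 M d 1 * g3 M d q.
Proof.
move=> M2 dM0 dM1 q1 Mq; rewrite -subr_gt0.
pose z := d - M; pose w := q - 1.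
have z0 : 0 < z by rewrite subr_gt0.
have z1 : z <= 1 by rewrite /z; lra.
have w0 : 0 < w by rewrite subr_gt0.
have Mw : M * w <= z by rewrite /z /w; lra.
have dE : d = M + z by rewrite /z; ring.
have qE : q = 1 + w by rewrite /w; ring.
move: z w dE qE z0 z1 w0 Mw {dM0 dM1 q1 Mq} => z w -> -> z0 z1 w0 Mw.
(* [e0] is half of [g2 M d 1], [K0] a sixth of [g3 M d 1], and [2 * M * w * X] is
   [g2 M d 1 - g2 M d q]. *)
pose X := 1 - z + (M + 1) * w / 2.
pose e0 := M * (M - 1 + 2 * z) / 2.
pose K0 := M * (M - 1) * (M - 2 + 3 * z) / 6.
pose Y := K0 + e0 - M * (M * w) * X - (2 / 3) * (M - 1) * w * e0.
rewrite (_ : _ - _ = 12 * M * w * (X * Y + (M - 1) / 2 * e0 * (w * (1 - z) / 3)));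
  last by rewrite /g2 /g3 /Y /X /K0 /e0; field.
have X0 : 0 < X.
  have : 0 < (M + 1) * w by rewrite mulr_gt0 //; lra.
  rewrite /X; lra.
have e00 : 0 < e0 by rewrite /e0 divr_gt0 // mulr_gt0; lra.
have Xle : X <= 1 - z + w / 2 + z / 2 by rewrite /X; lra.
have X1 : M * X <= M - (M - 1) * z / 2.
  have := ler_wpM2l (_ : 0 <= M) Xle; lra.
have Y0 : 0 < Y.
  (* The bound [M * w <= z], nonnegativity of the small part, removes [w] from the negative terms of
     [Y]. *)
  have H1 : M * (M * w) * X <= z * (M - (M - 1) * z / 2).
    rewrite (_ : _ * X = (M * w) * (M * X)); last by ring.
    have Mw0 : 0 <= M * w by apply: mulr_ge0; lra.
    have MX0 : 0 <= M * X by apply: mulr_ge0; lra.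
    exact: ler_pM.
  have H2 : (2 / 3) * (M - 1) * w * e0 <= (M - 1) * z * (M - 1 + 2 * z) / 3.
    rewrite (_ : _ * e0 = (M * w) * ((M - 1) * (M - 1 + 2 * z) / 3)); last by rewrite /e0; field.
    rewrite (_ : _ * z * _ / 3 = z * ((M - 1) * (M - 1 + 2 * z) / 3)); last by field.
    by rewrite ler_wpM2r // divr_ge0 // mulr_ge0; lra.
  apply: lt_le_trans (_ : (M - 1) * (M * (M + 1) + (M + 2) * z - z ^+ 2) / 6 <= _).
    rewrite divr_gt0 // mulr_gt0 //; first by lra.
    have : 0 <= z * (1 - z) by rewrite mulr_ge0; lra.
    have : 0 <= (M - 2) * z by rewrite mulr_ge0; lra.
    nra.
  rewrite /Y /K0 /e0 in H1 H2 *; lra.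
have M0 : 0 < M by lra.
rewrite pmulr_rgt0; last by rewrite !mulr_gt0.
rewrite ltr_wpDr ?mulr_gt0 //.
rewrite !mulr_ge0 ?invr_ge0 //; lra.
Qed.

(* The last two hypotheses are Goodman's inequality and the triangle bound for
   [M] in a link with [clq 1 = d], [clq 2 = E] and [clq 3 = F], where the unit of length is chosen such that p = 1. *)
Lemma link_gap M d th E F : 2 <= M -> 0 < th < 1 -> 0 <= d <= M + 1 ->
  E = th * g2 M d 1 -> 0 <= E -> 0 <= F ->
  (0 < d -> E * (2 * E - d ^+ 2) <= d * F) ->
  (forall q, d <= (M + 1) * q -> M * q <= d -> g2 M d q <= E ->
    g3 M d q <= F) ->
  th * (g3 M d 1 - 3 * (1 - th) * M * g2 M d 1) < F.
Proof.
move=> M2 /andP[th0 th1] /andP[d0 dM] EE Ege Fge HG HI.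
have M0 : 0 < M by lra.
set E0 := g2 M d 1 in EE *.
have E0ge : 0 <= E0 by rewrite -(pmulr_rge0 _ th0) -EE.
have [E00|E0n] := eqVneq E0 0.
  (* Here [d = (M + 1) / 2], and the lower bound is negative. *)
  apply: lt_le_trans Fge; rewrite E00 mulr0 subr0 pmulr_rlt0 //.
  have -> : g3 M d 1 = M * (M - 1) * (3 * d - 2 * (M + 1)) by rewrite /g3; ring.
  rewrite pmulr_rlt0; last by rewrite mulr_gt0 //; lra.
  have : M * (2 * d - (M + 1)) = 0 by rewrite -E00 /E0 /g2; ring.
  move/eqP; rewrite mulf_eq0 gt_eqF //= => /eqP; lra.
have {E0n}E0gt : 0 < E0 by rewrite lt_neqAle eq_sym E0n.
have dgt : (M + 1) / 2 < d.
  have : 0 < M * (2 * d - (M + 1)) by have -> : M * (2 * d - (M + 1)) = E0 by rewrite /E0 /g2; ring.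
  by rewrite pmulr_rgt0 //; lra.
have {d0}d0 : 0 < d by lra.
have Elt : E < E0 by rewrite EE gtr_pMl.
have gapE := goodman_gap M d; rewrite -/E0 in gapE.
set F0 := g3 M d 1 in gapE *.
have dd : M * d <= 3 * M * d - 2 * E0.
  have : 0 <= M * (d - (M + 1)) ^+ 2 by rewrite mulr_ge0 ?sqr_ge0 // ltW.
  have : 0 <= M * d * (M + 1 - d) by rewrite !mulr_ge0 //; lra.
  have : (M + 1) * (3 * M * d - 2 * E0 - M * d) =
     2 * (M * (d - (M + 1)) ^+ 2) + 2 * (M * d * (M + 1 - d)) by rewrite /E0 /g2; ring.
  move=> H ? ?; rewrite -subr_ge0 -(pmulr_rge0 _ (_ : 0 < M + 1)) ?H; last by lra.
  by rewrite addr_ge0 // mulr_ge0.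
(* Goodman's inequality suffices once the edges missing from [E0] outweigh the defect of
   [goodman_gap]. *)
have goodman : 2 * M * (d - M) * (1 - (d - M)) ^+ 2 < (E0 - E) * (3 * M * d - 2 * E0) ->
    th * (F0 - 3 * (1 - th) * M * E0) < F.
  move=> H; rewrite -(ltr_pM2l d0); apply: lt_le_trans (HG d0).
  rewrite -subr_gt0 (_ : _ - _ = th * ((E0 * (2 * E0 - d ^+ 2) - d * F0)
     + (E0 - E) * (3 * M * d - 2 * E0))); last by rewrite EE; ring.
  by rewrite mulr_gt0 // gapE; lra.
have [dleM|Mltd] := leP d M.
  apply: goodman; apply: le_lt_trans (_ : 0 < _).
    rewrite mulr_le0_ge0 ?sqr_ge0 // mulr_ge0_le0; lra.
  by apply: mulr_gt0; [rewrite subr_gt0|apply: lt_le_trans dd; exact: mulr_gt0].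
(* Below the density of [M] equal parts no admissible [q] represents [E], but enough edges are
   missing for Goodman's inequality. *)
have [El|Eg] := leP ((M - 1) * d ^+ 2) (M * E); last first.
  apply: goodman; set z := d - M.
  have z0 : 0 < z by rewrite subr_gt0.
  have z1 : z <= 1 by rewrite /z; lra.
  have H1 : z * (2 - z) <= E0 - E.
    rewrite -(ler_pM2l M0).
    have : 0 <= z ^+ 2 by rewrite sqr_ge0.
    have -> : M * (E0 - E) = (M * E0 - (M - 1) * d ^+ 2) + ((M - 1) * d ^+ 2 - M * E) by ring.
    have -> : M * E0 - (M - 1) * d ^+ 2 = M * z * (2 - z) + z ^+ 2 by rewrite /E0 /g2 /z; ring.
    lra.
  have z2 : 0 <= z * (2 - z) by apply: mulr_ge0; lra.
  have {H1}H1 := ler_pM z2 (mulr_ge0 (ltW M0) (ltW d0)) H1 dd.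
  apply: lt_le_trans H1.
  rewrite (_ : 2 * M * z * _ = z * (M * (2 * (1 - z) ^+ 2))); last by ring.
  rewrite (_ : z * (2 - z) * _ = z * (M * ((2 - z) * d))); last by ring.
  rewrite !ltr_pM2l //.
  have : 2 * (2 - z) <= (2 - z) * d by rewrite mulrC ler_wpM2l; lra.
  have : 0 <= z * (1 - z) by rewrite mulr_ge0; lra.
  lra.
have [|q [q1 qd Eq]] := link_reparam (_ : 1 <= M) (ltW Mltd) dM El Elt; first by lra.
have := HI q; rewrite -Eq lexx qd => /(_ _ isT isT) HF.
have {}HF := HF (_ : d <= (M + 1) * q).
have {}HF : g3 M d q <= F.
  apply: HF; apply: le_trans dM _; rewrite ler_pMr; lra.
have H := g3_concave_gap M2 Mltd dM q1 qd.
rewrite -(ltr_pM2l E0gt); apply: lt_le_trans (ler_wpM2l E0ge HF).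
by apply: le_lt_trans H; rewrite -Eq -/E0 -/F0 EE; lra.
Qed.

End RealInequalities.

(** * The triangle bound *)

Lemma continuous_powr (R : realType) (c : R) n : continuous (fun p : R => c * p ^+ n).
Proof.
apply: continuous_mulr; first exact: cst_continuous.
elim: n => [|n IHn]; first exact: cst_continuous.
rewrite (_ : (fun p => _) = (fun p => p * p ^+ n)).
  by apply: continuous_mulr => // p; exact: cvg_id.
by apply/funext => p; rewrite exprS.
Qed.

Lemma continuous_f3 (R : realType) (m : R) : continuous (f3 m).
Proof. by apply: continuous_subr; exact: continuous_powr. Qed.

Lemma continuous_f4 (R : realType) (m : R) : continuous (f4 m).
Proof. by apply: continuous_subr; exact: continuous_powr. Qed.

Section CliqueBounds.
Context {R : realType} {T : finType}.
Implicit Types (a : T -> T -> R) (x y : T -> R) (m M p k : R).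

Lemma simplex_clq1 a x : simplex x -> clq 1 a x = 1.
Proof. by case=> _ x1; rewrite clq1E. Qed.

Lemma simplex_deg_le1 a x i : weighting a -> simplex x -> 0 <= deg a x i <= 1.
Proof. by move=> aw xs; rewrite -(simplex_clq1 a xs); apply: deg_le; case: xs. Qed.

Lemma simplex_sum_gt0 x (f : T -> R) : simplex x ->
  (forall i, 0 < x i -> 0 < f i) -> 0 < \sum_i x i * f i.
Proof.
move=> [x0 x1] f0.
have xpos i : x i != 0 -> 0 < x i by move=> xn; rewrite lt_neqAle eq_sym xn x0.
have ge0 i : 0 <= x i * f i.
  have [->|xn] := eqVneq (x i) 0; first by rewrite mul0r.
  by rewrite mulr_ge0 // ltW // f0 // xpos.
rewrite lt_neqAle sumr_ge0 ?andbT //; apply/eqP => /esym/eqP.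
rewrite psumr_eq0 // => /allP z0.
have : \sum_i x i = 0.
  apply: big1 => i _; apply/eqP; have := z0 i (mem_index_enum _).
  rewrite /= mulf_eq0 => /orP[//|]; apply: contraTT => xn.
  by rewrite gt_eqF // f0 // xpos.
by rewrite x1; apply/eqP/oner_neq0.
Qed.

(** At both ends all parts have weight [p], so [m * p] is [1 - p] or 1; either value gives the same
    expressions in [p]. *)
Lemma endpoint_values m p : 1 <= m -> p = (m + 1)^-1 \/ p = m^-1 ->
  [/\ c2 m p = 1 - p, f3 m p = (1 - p) * (1 - 2 * p)
    & f4 m p = (1 - p) * (1 - 2 * p) * (1 - 3 * p)].
Proof.
move=> m1 hp.
have [s [sE hs]] : exists s, s = m * p /\ (s = 1 - p \/ s = 1).
  exists (m * p); split=> //; case: hp => ->; [left|right].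
    have : m + 1 != 0 by rewrite gt_eqF //; lra.
    by move=> ?; field.
  by rewrite mulfV // gt_eqF //; lra.
have -> : c2 m p = s * (2 - s - p) by rewrite sE /c2; ring.
have -> : f3 m p = s * (s - p) * (3 - 2 * (s + p)) by rewrite sE /f3; ring.
have -> : f4 m p = s * (s - p) * (s - 2 * p) * (4 - 3 * (s + p)).
  by rewrite sE /f4; ring.
by case: hs => ->; split; ring.
Qed.

(** Goodman's bound [w * (2 * w - 1)] increases with the edge weight [w] in this range and equals
    [f3] for equal parts. *)
Lemma endpoint_triangles m a x p : 2 <= m -> feasible m a x p ->
  p = (m + 1)^-1 \/ p = m^-1 -> f3 m p <= clq 3 a x.
Proof.
move=> m2 [aw xs pr H2] hp; have m1 : 1 <= m by lra.
have [c2E -> _] := endpoint_values m1 hp; rewrite c2E in H2.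
have [p0 _ mp _] := range_bounds m1 pr.
have W1 := simplex_clq1 a xs.
have := clq3_goodman aw xs.1; rewrite W1 expr1n mul1r => /(_ ltr01).
apply: le_trans.
have p2 : 2 * p <= 1 by apply: le_trans mp; rewrite ler_pM2r.
have : 0 <= (clq 2 a x - (1 - p)) * (2 * clq 2 a x + 1 - 2 * p).
  by apply: mulr_ge0; lra.
lra.
Qed.

(** Goodman's inequality is fed into that of Moon and Moser; the outcome
    [w * (2 * w - 1) * (3 * w - 2)] equals [f4] for equal parts. *)
Lemma endpoint_K4 m a x p : 3 <= m -> feasible m a x p ->
  p = (m + 1)^-1 \/ p = m^-1 -> f4 m p <= clq 4 a x.
Proof.
move=> m3 [aw xs pr H2] hp; have m1 : 1 <= m by lra.
have [c2E _ ->] := endpoint_values m1 hp; rewrite c2E in H2.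
have [p0 _ mp _] := range_bounds m1 pr.
have W1 := simplex_clq1 a xs.
have := clq3_goodman aw xs.1; rewrite W1 expr1n mul1r => /(_ ltr01) HG.
have p3 : 3 * p <= 1 by apply: le_trans mp; rewrite ler_pM2r.
set w := clq 2 a x in H2 HG; have w0 : 0 < w by lra.
have := clq4_moon_moser aw xs.1 W1 w0; rewrite -/w.
set t := clq 3 a x in HG *; set q := clq 4 a x => HM.
pose g := w * (2 * w - 1).
have g0 : 0 <= g by apply: mulr_ge0; lra.
have gw : 0 <= 3 * g - w.
  have : 0 <= w * (6 * w - 4) by apply: mulr_ge0; lra.
  rewrite /g; lra.
have H1 : g * (3 * g - w) <= t * (3 * t - w).
  have gt : g <= t by rewrite /g; lra.
  apply: ler_pM => //; lra.
have H3 : (2 * w - 1) * w * (3 * w - 2) <= q.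
  rewrite -(ler_pM2l w0); rewrite /g in H1; lra.
apply: le_trans H3.
rewrite (_ : (2 * w - 1) * w * _ = w * (2 * w - 1) * (3 * w - 2)); last by ring.
have q1 : 0 <= 1 - p by lra.
have q2 : 0 <= 1 - 2 * p by lra.
have q3 : 0 <= 1 - 3 * p by lra.
apply: ler_pM; [exact: mulr_ge0|exact: q3| |lra].
by apply: ler_pM => //; lra.
Qed.

Definition triangle_bound M : Prop :=
  forall a x p, feasible M a x p -> f3 M p <= clq 3 a x.

(** [g2] and [g3] are the homogeneous forms of [c2] and [f3], so the weights can be divided by their
    total. *)
Lemma triangle_bound_scaled M a y p : 0 < M -> triangle_bound M ->
  weighting a -> (forall i, 0 <= y i) -> 0 < clq 1 a y ->
  clq 1 a y <= (M + 1) * p -> M * p <= clq 1 a y ->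
  g2 M (clq 1 a y) p <= clq 2 a y -> g3 M (clq 1 a y) p <= clq 3 a y.
Proof.
move=> M0 HM aw y0 d0 Hlo Hhi H2.
set d := clq 1 a y in d0 Hlo Hhi H2 *.
have M1 : 0 < M + 1 by lra.
have dn : d != 0 by rewrite gt_eqF.
have fe : feasible M a (fun i => d^-1 * y i) (p / d).
  split=> //.
  - split=> [i|]; first by rewrite mulr_ge0 // invr_ge0 ltW.
    by rewrite -mulr_sumr -(clq1E a) mulVf.
  - apply/andP; split.
      by rewrite ler_pdivlMr // ler_pdivrMl.
    by rewrite ler_pdivrMr // ler_pdivlMl.
  - rewrite clq_scale (_ : c2 M (p / d) = d^-1 ^+ 2 * g2 M d p); last by rewrite /c2 /g2; field.
    by rewrite ler_pM2l // exprn_gt0 // invr_gt0.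
have := HM _ _ _ fe.
rewrite clq_scale (_ : f3 M (p / d) = d^-1 ^+ 3 * g3 M d p); last by rewrite /f3 /g3; field.
by rewrite ler_pM2l // exprn_gt0 // invr_gt0.
Qed.

Lemma feasible_interior m a x p : feasible m a x p ->
  p <> (m + 1)^-1 -> p <> m^-1 -> (m + 1)^-1 < p /\ p < m^-1.
Proof.
move=> [_ _ /andP[lo hi] _] n1 n2; rewrite !lt_neqAle lo hi !andbT.
by split; apply/eqP => // e; apply: n1.
Qed.

(** [L] is a third of [k] times the multiplier of [f3]. The edge rule is applied to [nonadj], which
    feeds [clq4_upper]. *)
Lemma minimizer_triangles m k a x p : 1 < m -> 0 < k ->
  (m + 1)^-1 < p -> p < m^-1 -> minimizer m 3 k (f3 m) a x p ->
  let L := k * (m - 1) * p in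
  [/\ clq 2 a x = c2 m p,
      forall i, x i * clq 2 a (link a x i) =
        x i * (2 * L * deg a x i + (clq 3 a x - 2 * L * clq 2 a x)),
      forall i, x i * clq 2 a (link a x i) <= L * (x i * deg a x i) &
      clq 4 a x <= 3 * (clq 3 a x - 2 * L * clq 2 a x) * clq 2 a x
        + 3 * L * clq 2 a x + 3 * L * clq 3 a x - 2 * clq 3 a x].
Proof.
move=> m1 k0 lop phi Hmin L.
have [[aw xs pr _] _] := Hmin; have m1' : 1 <= m by exact: ltW.
have m0 : 0 < m by lra.
have [p0 _ _ _] := range_bounds m1' pr.
have lam0 : 0 < 3 * (m - 1) * p by rewrite !mulr_gt0 //; lra.
have Hmul := multiplier_f3 m1' pr.
have V i : x i * clq 2 a (link a x i) =
    x i * (2 * L * deg a x i + (clq 3 a x - 2 * L * clq 2 a x)).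
  have := minimizer_vertex_eq m0 k0 lam0 lop phi Hmin Hmul i; rewrite /L; lra.
split=> //.
- exact: minimizer_clq2 m0 k0 lam0 lop phi Hmin Hmul.
- move=> i; have := minimizer_star m0 k0 lam0 lop phi Hmin Hmul i; rewrite /L; lra.
- have HE := minimizer_edge m0 k0 lam0 lop phi Hmin Hmul
    (nonadjC a x) (fun i j => nonadj_bounds i j aw xs.1 (simplex_clq1 a xs)).
  have {}HE : tri_sum a x (fun i j _ => nonadj a x i j) <= L * edge_sum a x (nonadj a x).
    by rewrite /L; lra.
  have := clq4_upper aw xs V HE; lra.
Qed.

Lemma triangle_bound2 : triangle_bound 2.
Proof.
move=> a1 x1 p1 fe1; rewrite leNgt; apply/negP => bad.
have [a [x [p [fe Hm]]]] := exists_minimum 3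
  (fun p _ => @cst_continuous _ _ (1 : R) p) (continuous_f3 (m := 2)) fe1.
have Hmin : minimizer 2 3 1 (f3 2) a x p.
  split=> // a' x' p' fe'; rewrite !mul1r; have := Hm _ _ _ fe'; lra.
have W3lt : clq 3 a x < f3 2 p by have := Hm _ _ _ fe1; lra.
have m2 : (2 : R) <= 2 by [].
have [lop phi] : (2 + 1)^-1 < p /\ p < 2^-1.
  apply: (feasible_interior fe) => e; have := endpoint_triangles m2 fe.
    by move=> /(_ (or_introl e)); lra.
  by move=> /(_ (or_intror e)); lra.
have m1 : (1 : R) < 2 by lra.
have [clq2E _ _ H4] := minimizer_triangles m1 ltr01 lop phi Hmin.
have [[aw xs pr _] _] := Hmin.
have a0 i j : 0 <= a i j by case: aw => _ _ /(_ i j)/andP[].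
have W40 : 0 <= clq 4 a x by apply: clq_ge0 => //; exact: xs.1.
have [_ _ p2 p3] := range_bounds (ltW m1) pr.
(* Slope in [clq 3] of the upper bound on [clq 4], which vanishes at [clq 3 = f3 2 p]. *)
have c0 : 0 < 15 * p - 18 * p ^+ 2 - 2.
  have : 0 <= (3 * p - 1) * (1 - 2 * p) by apply: mulr_ge0; lra.
  lra.
have := ltr_pM2r c0 (clq 3 a x) (f3 2 p); rewrite W3lt.
move: H4; rewrite clq2E /c2 /f3; set t := clq 3 a x.
lra.
Qed.

Lemma triangle_boundS M : 2 <= M -> triangle_bound M -> triangle_bound (M + 1).
Proof.
move=> M2 IH a1 x1 p1 fe1; rewrite leNgt; apply/negP => bad.
set m := M + 1 in fe1 bad *.
have m2 : 2 <= m by rewrite /m; lra.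
have m1 : 1 < m by lra.
have f3gt0 p : (m + 1)^-1 <= p <= m^-1 -> 0 < f3 m p.
  move=> pr; have [p0 _ mp _] := range_bounds (ltW m1) pr.
  have -> : f3 m p = m * (m - 1) * p ^+ 2 * (3 - 2 * (m * p) - 2 * p) by rewrite /f3; ring.
  have : 3 * p <= m * p by rewrite ler_pM2r // /m; lra.
  move=> ?; rewrite !mulr_gt0 ?exprn_gt0 //; lra.
have cf (p : R) : (m + 1)^-1 <= p <= m^-1 -> {for p, continuous (fun q => (f3 m q)^-1)}.
  move=> /f3gt0 f0; apply: continuousV; first by rewrite gt_eqF.
  exact: continuous_f3.
have [a [x [p [fe Hm]]]] := exists_minimum 3 cf (@cst_continuous _ _ (0 : R)) fe1.
(* The least ratio, which takes the place of [th] in [link_gap]. *)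
pose k := clq 3 a x / f3 m p.
have [aw xs pr H2] := fe.
have f0 := f3gt0 p pr.
have W3E : clq 3 a x = k * f3 m p by rewrite /k divfK // gt_eqF.
have Hk a' x' p' : feasible m a' x' p' -> k * f3 m p' <= clq 3 a' x'.
  move=> fe'; have := Hm _ _ _ fe'; rewrite !subr0 -/k.
  by rewrite ler_pdivlMr //; apply: f3gt0; case: fe'.
have f10 : 0 < f3 m p1 by apply: f3gt0; case: fe1.
have k1 : k < 1.
  by rewrite -(ltr_pM2r f10) mul1r; apply: le_lt_trans (Hk _ _ _ fe1) bad.
have a0 i j : 0 <= a i j by case: aw => _ _ /(_ i j)/andP[].
have [x0 x1s] := xs.
have [p0 _ mp mp1] := range_bounds (ltW m1) pr.
(* On the interval [c2 m p >= 1 - p > 1 / 2], so Goodman's inequality forces triangles. *)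
have k0 : 0 < k.
  have := clq3_goodman aw x0; rewrite (simplex_clq1 a xs) expr1n mul1r => /(_ ltr01).
  rewrite W3E -(pmulr_lgt0 _ f0); apply: lt_le_trans.
  have : 1 - p <= clq 2 a x.
    apply: le_trans H2; rewrite -subr_ge0.
    have -> : c2 m p - (1 - p) = ((m + 1) * p - 1) * (1 - m * p) by rewrite /c2; ring.
    by apply: mulr_ge0; lra.
  have : 3 * p <= m * p by rewrite ler_pM2r // /m; lra.
  by move=> *; apply: mulr_gt0; lra.
have Hmin : minimizer m 3 k (f3 m) a x p.
  by split=> // a' x' p' fe'; rewrite W3E subrr subr_ge0; exact: Hk.
have [lop phi] : (m + 1)^-1 < p /\ p < m^-1.
  have kf : k * f3 m p < f3 m p by rewrite gtr_pMl.
  apply: (feasible_interior fe) => e; have := endpoint_triangles m2 fe.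
    by move=> /(_ (or_introl e)); lra.
  by move=> /(_ (or_intror e)); lra.
have [W2c V S H4] := minimizer_triangles m1 k0 lop phi Hmin.
(* The lower bound of [link_gap] for [th = k], scaled back to unit [p]-free length; it is affine in
   the degree. *)
pose rhs i := k * (g3 M (deg a x i) p - 3 * (1 - k) * M * p * g2 M (deg a x i) p).
have gap i : 0 < x i -> rhs i < clq 3 a (link a x i).
  move=> xi0; set d := deg a x i.
  set y := link a x i.
  have y0 j : 0 <= y j by rewrite /y /link mulr_ge0.
  have W1y : clq 1 a y = d by exact: clq1_link.
  (* Since [clq 3 a x] is exactly [k * f3 m p], the vertex rule becomes proportional to [k]. *)
  have Ey : clq 2 a y = k * g2 M d p.
    apply: (mulfI (lt0r_neq0 xi0)); rewrite V W3E W2c /c2 /f3 /g2 -/d /m.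
    by ring.
  (* In the star rule [k] cancels, which leaves the largest degree [m * p] of the extremal graph. *)
  have dmp : d <= (M + 1) * p.
    have := S i; rewrite -/y -/d mulrCA ler_pM2l // Ey.
    have -> : k * (m - 1) * p * d = k * (M * p * d) by rewrite /m; ring.
    rewrite ler_pM2l //.
    have -> : g2 M d p = M * p * (2 * d - (M + 1) * p) by rewrite /g2; ring.
    rewrite ler_pM2l ?mulr_gt0 //; lra.
  have d0 : 0 <= d by have /andP[] := deg_le i aw x0.
  have pn : p != 0 by rewrite gt_eqF.
  have := @link_gap R M (d / p) k (clq 2 a y / p ^+ 2) (clq 3 a y / p ^+ 3) M2.
  rewrite k0 k1 => /(_ isT) H.
  have {}H : k * (g3 M (d / p) 1 - 3 * (1 - k) * M * g2 M (d / p) 1) < clq 3 a y / p ^+ 3.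
    apply: H.
    - by rewrite divr_ge0 ?(ltW p0) //= ler_pdivrMr.
    - by rewrite Ey /g2; field.
    - by rewrite divr_ge0 ?exprn_ge0 ?(ltW p0) //; apply: clq_ge0.
    - by rewrite divr_ge0 ?exprn_ge0 ?(ltW p0) //; apply: clq_ge0.
    - rewrite pmulr_lgt0 ?invr_gt0 // => dp.
      have := clq3_goodman aw y0; rewrite W1y => /(_ dp) HG.
      rewrite -subr_ge0 (_ : _ - _ = (d * clq 3 a y - clq 2 a y * (2 * clq 2 a y - d ^+ 2)) / p ^+ 4); last by field.
      by rewrite divr_ge0 ?subr_ge0 ?exprn_ge0 // ltW.
    - move=> q q1 q2 q3; rewrite ler_pdivlMr ?exprn_gt0 //.
      have -> : g3 M (d / p) q * p ^+ 3 = g3 M d (q * p) by rewrite /g3; field.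
      have dq1 : d <= (M + 1) * (q * p) by rewrite mulrA -ler_pdivrMr.
      have dq2 : M * (q * p) <= d by rewrite mulrA -ler_pdivlMr.
      have dq3 : g2 M d (q * p) <= clq 2 a y.
        have -> : g2 M d (q * p) = g2 M (d / p) q * p ^+ 2 by rewrite /g2; field.
        by rewrite -ler_pdivlMr // exprn_gt0.
      (* Normalizing the link requires positive total weight; for [d = 0] the bounds force
         [q * p = 0]. *)
      have [d00|dn] := eqVneq d 0.
        have qp0 : q * p = 0.
          rewrite d00 in dq1 dq2; apply/eqP; rewrite eq_le; apply/andP; split.
            by rewrite -(pmulr_rle0 _ (_ : 0 < M)) //; lra.
          by rewrite -(pmulr_rge0 _ (_ : 0 < M + 1)) //; lra.
        by rewrite /g3 qp0 !expr0n /= !(mulr0, mul0r) subr0 clq_ge0.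
      have := @triangle_bound_scaled M a y (q * p) _ IH aw y0.
      rewrite W1y; apply=> //; first by lra.
      by rewrite lt_neqAle eq_sym dn.
  have -> : rhs i = k * (g3 M (d / p) 1 - 3 * (1 - k) * M * g2 M (d / p) 1) * p ^+ 3.
    by rewrite /rhs -/d /g3 /g2; field.
  by rewrite -ltr_pdivlMr // exprn_gt0.
have : 0 < \sum_i x i * (clq 3 a (link a x i) - rhs i).
  by apply: simplex_sum_gt0 => // i xi; rewrite subr_gt0 gap.
pose A := k * (3 * M * (M - 1) * p ^+ 2 - 6 * (1 - k) * M ^+ 2 * p ^+ 2).
pose B := k * (- 2 * (M + 1) * M * (M - 1) * p ^+ 3 + 3 * (1 - k) * M ^+ 2 * (M + 1) * p ^+ 3).
have -> : \sum_i x i * (clq 3 a (link a x i) - rhs i) = clq 4 a x - (A * clq 2 a x + B).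
  transitivity (\sum_i (x i * clq 3 a (link a x i) + (- A * (x i * deg a x i) + - B * x i))).
    by apply: eq_bigr => i _; rewrite /rhs /g3 /g2 /A /B; ring.
  by rewrite !big_split /= -!mulr_sumr -clqS -clq2E x1s; ring.
(* The strict lower bound and the upper bound on [clq 4] are the same polynomial in [k] and [p]. *)
rewrite subr_gt0 => lt4; have := lt_le_trans lt4 H4.
rewrite W3E W2c (_ : A * _ + B = 3 * (k * f3 m p - 2 * (k * (m - 1) * p) * c2 m p) *
  c2 m p + 3 * (k * (m - 1) * p) * c2 m p + 3 * (k * (m - 1) * p) * (k * f3 m p) -
  2 * (k * f3 m p)) ?ltxx //.
by rewrite /A /B /c2 /f3 /m; ring.
Qed.

End CliqueBounds.

(** * The K_4 bound *)

Section K4Bound.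
Context {R : realType} {T : finType}.
Implicit Types (a : T -> T -> R) (x y : T -> R) (m M p k : R).

(** By contradiction, in three ranges of the total weight [d]: Goodman's inequality up to [M * p],
    the triangle bound at [p] up to [(M + 1) * p], and beyond it the triangle bound at the other
    root of [g2 M d q = g2 M d p]. *)
Lemma link_edges_lt M a y p : 2 <= M -> @triangle_bound R T M ->
  weighting a -> (forall i, 0 <= y i) -> 0 < p -> clq 1 a y < (M + 2) * p ->
  clq 3 a y < g3 M (clq 1 a y) p -> clq 3 a y <= M * (M - 1) * p ^+ 2 * clq 1 a y ->
  clq 2 a y < g2 M (clq 1 a y) p.
Proof.
move=> M2 HT aw y0 p0 dlt Flt Fle; rewrite ltNge; apply/negP => Ege.
have M0 : 0 < M by lra.
have [_ _ a01] := aw; have a0 i j : 0 <= a i j by have /andP[] := a01 i j.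
have F0 : 0 <= clq 3 a y by apply: clq_ge0.
have HS q := triangle_bound_scaled (p := q) M0 HT aw y0.
have HG := clq3_goodman aw y0.
set d := clq 1 a y in dlt Flt Fle Ege HS HG *; set E := clq 2 a y in Ege HS HG *.
set F := clq 3 a y in Flt Fle F0 HS HG *.
have dbig : 2 * (M + 1) * p < 3 * d.
  have := le_lt_trans F0 Flt.
  have -> : g3 M d p = M * (M - 1) * p ^+ 2 * (3 * d - 2 * (M + 1) * p).
    by rewrite /g3; ring.
  by rewrite pmulr_rgt0 ?subr_gt0 // !mulr_gt0 ?exprn_gt0 // subr_gt0; lra.
have Mp : 0 < M * p by rewrite mulr_gt0.
have d0 : 0 < d by lra.
have [dle|dgt] := leP d (M * p).
  have gap : 0 <= g2 M d p * (2 * g2 M d p - d ^+ 2) - d * g3 M d p.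
    have -> : g2 M d p * (2 * g2 M d p - d ^+ 2) - d * g3 M d p =
      2 * (M * p) * ((M * p - d) * (p - (d - M * p)) ^+ 2).
      by rewrite /g2 /g3; ring.
    apply: mulr_ge0; first by rewrite mulr_ge0 // ltW.
    by apply: mulr_ge0; rewrite ?sqr_ge0 ?subr_ge0.
  have g20 : 0 < g2 M d p.
    have -> : g2 M d p = M * p * (2 * d - (M + 1) * p) by rewrite /g2; ring.
    by rewrite mulr_gt0 //; lra.
  have dF : 0 <= d * F by rewrite mulr_ge0 // ltW.
  have dFlt : d * F < d * g3 M d p by rewrite ltr_pM2l.
  have h0 : 0 < 2 * g2 M d p - d ^+ 2.
    by rewrite -(pmulr_rgt0 _ g20); lra.
  have : g2 M d p * (2 * g2 M d p - d ^+ 2) <= E * (2 * E - d ^+ 2).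
    have h : 2 * g2 M d p - d ^+ 2 <= 2 * E - d ^+ 2 by lra.
    exact: ler_pM (ltW g20) (ltW h0) Ege h.
  by have := HG d0; lra.
have [dle|dgt'] := leP d ((M + 1) * p).
  by have := HS p d0 dle (ltW dgt) Ege; lra.
have M1n : M + 1 != 0 by rewrite gt_eqF //; lra.
(* The axis of [g2 M d] is [d / (M + 1) = p + u / 2], so [p + u] is the mirror image of [p]. *)
have [u [u0 dE]] : exists u, 0 < u /\ d = (M + 1) * (p + u / 2).
  exists (2 * (d - (M + 1) * p) / (M + 1)); split; last by field.
  by rewrite divr_gt0 // ?mulr_gt0 // ?subr_gt0 //; lra.
have ult : (M + 1) * u < 2 * p by lra.
have M1u : 3 * u <= (M + 1) * u by rewrite ler_pM2r //; lra.
have := HS (p + u) d0.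
have -> : g2 M d (p + u) = g2 M d p by rewrite /g2 dE; field.
have -> : d <= (M + 1) * (p + u).
  by rewrite dE ler_pM2l; lra.
have -> : M * (p + u) <= d by rewrite dE; lra.
move=> /(_ isT isT Ege).
(* At [p + u] the triangle bound exceeds the bound [Fle], linear in [d]. *)
apply/negP; rewrite -ltNge; apply: le_lt_trans Fle _.
rewrite -subr_gt0 (_ : _ - _ = M * (M - 1) * (M + 1) / 2 * (u * (p ^+ 2 + (p - u) * (p + u)))).
  rewrite mulr_gt0 //; first by rewrite divr_gt0 // !mulr_gt0 //; lra.
  rewrite mulr_gt0 // ltr_wpDr ?exprn_gt0 // mulr_ge0; lra.
by rewrite /g3 dE; field.
Qed.

Lemma K4_bound m a x p : 3 <= m ->
  @triangle_bound R T (m - 1) -> @triangle_bound R T m ->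
  feasible m a x p -> f4 m p <= clq 4 a x.
Proof.
move=> m3 HTM HTm fe1; rewrite leNgt; apply/negP => bad.
have m1 : 1 <= m by lra.
have m0 : 0 < m by lra.
have [{bad fe1}a [{}x [{}p [fe [Hm bad]]]]] : exists a x p, feasible m a x p /\
    (minimizer m 4 1 (f4 m) a x p /\ clq 4 a x < f4 m p).
  have [a' [x' [p' [fe Hm]]]] := exists_minimum 4
    (fun p _ => @cst_continuous _ _ (1 : R) p) (continuous_f4 (m := m)) fe1.
  exists a', x', p'; split=> //; split; last by have := Hm _ _ _ fe1; lra.
  split=> // a2 x2 p2 fe2; rewrite !mul1r; have := Hm _ _ _ fe2; lra.
have [lop phi] : (m + 1)^-1 < p /\ p < m^-1.
  apply: (feasible_interior fe) => e; have := endpoint_K4 m3 fe.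
    by move=> /(_ (or_introl e)); lra.
  by move=> /(_ (or_intror e)); lra.
have [aw xs pr _] := fe.
have [p0 _ _ mp] := range_bounds m1 pr.
have [_ _ a01] := aw; have a0 i j : 0 <= a i j by have /andP[] := a01 i j.
have lam0 : 0 < 6 * (m - 1) * (m - 2) * p ^+ 2.
  by rewrite !mulr_gt0 ?exprn_gt0 //; lra.
have m2 : 2 <= m by lra.
have Hmul := multiplier_f4 m2 pr.
have V := minimizer_vertex_eq m0 ltr01 lam0 lop phi Hm Hmul.
have S := minimizer_star m0 ltr01 lam0 lop phi Hm Hmul.
have W2c := minimizer_clq2 m0 ltr01 lam0 lop phi Hm Hmul.
have mp' : 1 < (m + 1) * p by rewrite -ltr_pdivrMl ?mulr1 //; lra.
(* With [M = m - 1], the rule [V] and [clq 4 a x < f4 m p] put the triangles of the link below [g3],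
   while [S] bounds them linearly in the degree. *)
have edges i : 0 < x i -> 0 < g2 (m - 1) (deg a x i) p - clq 2 a (link a x i).
  move=> xi; rewrite subr_gt0 -clq1_link; apply: link_edges_lt => //.
  - lra.
  - by move=> j; rewrite /link mulr_ge0 //; case: xs.
  - have /andP[_ d1] := simplex_deg_le1 i aw xs; rewrite clq1_link.
    by apply: le_lt_trans d1 _; have -> : m - 1 + 2 = m + 1 by ring.
  - rewrite clq1_link -(ltr_pM2l (_ : 0 < 4 * x i)); last by rewrite mulr_gt0.
    have := V i; have : x i * clq 4 a x < x i * f4 m p by rewrite ltr_pM2l.
    rewrite W2c /c2 /f4 /g3; lra.
  - rewrite clq1_link -(ler_pM2l (_ : 0 < 12 * x i)); last by rewrite mulr_gt0.
    by have := S i; lra.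
have := simplex_sum_gt0 xs edges.
(* As [g2] is affine in the degree, its weighted sum involves only [clq 2 a x], which is
   [c2 m p]. *)
have -> : \sum_i x i * (g2 (m - 1) (deg a x i) p - clq 2 a (link a x i)) =
    f3 m p - clq 3 a x.
  transitivity (\sum_i (2 * (m - 1) * p * (x i * deg a x i) +
     (- (m - 1) * m * p ^+ 2 * x i - x i * clq 2 a (link a x i)))).
    by apply: eq_bigr => i _; rewrite /g2; ring.
  rewrite !big_split /= sumrN -!mulr_sumr -clqS -clq2E xs.2 W2c /c2 /f3; ring.
by have := HTm _ _ _ fe; lra.
Qed.

End K4Bound.

(** * Unordered cliques and the extremal configuration *)

(** A pair with [i] may be ordered either way; by symmetry of [A] both orders contribute [A i j]. *)
Lemma pair_prod_setU1 (R : realType) n (A : 'M[R]_n) (i : 'I_n) (X : {set 'I_n}) :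
  A^T = A -> i \notin X ->
  \prod_(k in i |: X) \prod_(j in i |: X | (k < j)%N) A k j =
  (\prod_(j in X) A i j) * \prod_(k in X) \prod_(j in X | (k < j)%N) A k j.
Proof.
move=> AT iX.
pose P (Y : {set 'I_n}) (k : 'I_n) : R := \prod_(j in Y | (k < j)%N) A k j.
have PU k : P (i |: X) k = (if (k < i)%N then A k i else 1) * P X k.
  by rewrite /P !big_mkcondr big_setU1.
rewrite -[LHS]/(\prod_(k in i |: X) P (i |: X) k).
rewrite -[X in _ = _ * X]/(\prod_(k in X) P X k).
rewrite big_setU1 //= PU ltnn mul1r.
under eq_bigr do rewrite PU.
rewrite big_split mulrA; congr (_ * _).
rewrite /P big_mkcondr -big_split /=; apply: eq_bigr => j jX.
have ji : j != i by apply: contraNneq iX => <-.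
rewrite -{2}AT mxE; have [ij|] := ltnP i j.
  by rewrite ltnNge (ltnW ij) mulr1.
by rewrite leq_eqVlt (negPf (ji : (j != i :> nat))) /= => ->; rewrite mul1r.
Qed.

(** Double counting of sets with a chosen vertex [i]. The link gives [i] weight 0, so only sets
    avoiding [i] remain, and adding [i] is a bijection onto the larger sets through [i]. *)
Lemma Lr_link (R : realType) n r (A : 'M[R]_n) (x : 'rV[R]_n) :
  A^T = A -> (forall i, A i i = 0) ->
  r.+1%:R * Lr r.+1 A x = \sum_i x 0 i * Lr r A (\row_j link A (x 0) i j).
Proof.
move=> AT Aii; pose v (Y : {set 'I_n}) : R :=
  (\prod_(i in Y) \prod_(j in Y | (i < j)%N) A i j) * \prod_(i in Y) x 0 i.
transitivity (\sum_(Y : {set 'I_n} | #|Y| == r.+1) \sum_(i in Y) v Y).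
  rewrite /Lr mulr_sumr; apply: eq_bigr => Y /eqP Yr.
  by rewrite sumr_const Yr mulr_natl.
rewrite (exchange_big_dep predT) //=; apply: eq_bigr => i _.
rewrite /Lr mulr_sumr [RHS](bigID (fun X : {set 'I_n} => i \in X)) /=.
rewrite [X in _ = X + _]big1 ?add0r; last first.
  move=> X /andP[_ iX]; rewrite [X in _ * (_ * X)](bigD1 i) //= mxE /link Aii.
  by rewrite mul0r !mul0r !mulr0.
rewrite (reindex_onto (fun X : {set 'I_n} => i |: X) (fun Y => Y :\ i)) /=; last first.
  by move=> Y /andP[_ iY]; rewrite finset.setD1K.
apply: eq_big => X.
  rewrite finset.setU11 andbT; have [iX|iX] := boolP (i \in X); last first.
    by rewrite cardsU1 iX add1n eqSS finset.setU1K // eqxx !andbT.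
  rewrite andbF; apply/negP => /andP[_ /eqP e].
  by move: iX; rewrite -e !inE eqxx.
move=> /andP[_ /eqP e]; have iX : i \notin X by rewrite -e !inE eqxx.
rewrite /v pair_prod_setU1 // big_setU1 //=.
rewrite [X in _ = _ * (_ * X)](eq_bigr (fun j => A i j * x 0 j)); last by move=> j _; rewrite mxE.
by rewrite big_split /=; ring.
Qed.

Lemma Lr_clq (R : realType) n r (A : 'M[R]_n) (x : 'rV[R]_n) :
  A^T = A -> (forall i, A i i = 0) -> r`!%:R * Lr r A x = clq r A (x 0).
Proof.
move=> AT Aii; elim: r x => [|r IHr] x.
  rewrite clq0 /Lr (big_pred1 finset.set0) => [|X]; last by rewrite cards_eq0.
  by rewrite !big_set0 !mulr1.
rewrite factS natrM (mulrC r.+1%:R) -mulrA Lr_link //.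
rewrite mulr_sumr clqS; apply: eq_bigr => i _; rewrite mulrCA IHr; congr (_ * clq _ _ _).
by apply/funext => j; rewrite mxE.
Qed.

Lemma weighting_mx (R : realType) n (A : 'M[R]_n) :
  weight_matrices A -> weighting A.
Proof. by move=> [AT Aii A01]; split=> // i j; rewrite -{1}AT mxE. Qed.

Lemma complete_weight (R : realType) n : weight_matrices (complete_mx R n).
Proof.
split=> [|i|i j]; first by apply/matrixP => i j; rewrite !mxE eq_sym.
  by rewrite mxE eqxx.
by rewrite mxE; case: (_ != _); rewrite lexx ler01.
Qed.

(** * Cliques of complete graphs *)

Section CompleteGraph.
Context {R : realType} (m : nat).
Let A : 'M[R]_m.+1 := complete_mx R m.+1.
Let one : 'I_m.+1 -> R := fun _ => 1.
Let aw : weighting A. Proof. exact/weighting_mx/complete_weight. Qed.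

(** With unit weights, the link of [i] is the shift by -1 at [i], so [clq_shift] applies. *)
Lemma clq_complete_rec r i :
  clq r.+1 A (link A one i) = clq r.+1 A one - r.+1%:R * clq r A (link A one i).
Proof.
have -> : link A one i = (fun k => 1 * one k + -1 * (k == i)%:R).
  by apply/funext => k; rewrite /link mxE /one eq_sym; case: eqP => _ /=; ring.
have E : (fun k : 'I_m.+1 => 1 * one k + -1 * (k == i)%:R) = link A one i.
  by apply/funext => k; rewrite /link mxE /one eq_sym; case: eqP => _ /=; ring.
by rewrite clq_shift // E !expr1n; ring.
Qed.

(** Falling factorials; the two counts are proved together because each feeds the other in the
    recursion. *)
Lemma clq_complete r : clq r A one = \prod_(k < r) (m.+1%:R - k%:R) /\
  forall i, clq r A (link A one i) = \prod_(k < r) (m%:R - k%:R).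
Proof.
elim: r => [|r [IHu IHv]].
  by rewrite clq0 big_ord0; split=> // i; rewrite clq0 big_ord0.
have u : clq r.+1 A one = m.+1%:R * \prod_(k < r) (m%:R - k%:R).
  rewrite clqS (eq_bigr (fun=> \prod_(k < r) (m%:R - k%:R))).
    by rewrite sumr_const card_ord mulr_natl.
  by move=> i _; rewrite IHv mul1r.
split.
  rewrite u big_ord_recl /= subr0; congr (_ * _); apply: eq_bigr => k _.
  by rewrite /bump /= add1n -!natr1; ring.
move=> i; rewrite clq_complete_rec u IHv big_ord_recr /= -!natr1; ring.
Qed.

Lemma clq_complete_uneven r (p q : R) :
  clq r.+1 A (fun i => if (i.+1 < m.+1)%N then p else q) =
  p ^+ r.+1 * \prod_(k < r.+1) (m.+1%:R - k%:R) +
  r.+1%:R * (q - p) * p ^+ r * \prod_(k < r) (m%:R - k%:R).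
Proof.
have -> : (fun i : 'I_m.+1 => if (i.+1 < m.+1)%N then p else q) =
   (fun i => 1 * (p * one i) + (q - p) * (i == ord_max)%:R).
  apply/funext => i; rewrite /one -val_eqE /= ltnS ltn_neqAle -ltnS ltn_ord andbT.
  by case: eqP => _ /=; ring.
have lnk i : link A (fun j => p * one j) i = (fun j => p * link A one i j).
  by apply/funext => j; rewrite /link; ring.
rewrite clq_shift // lnk !clq_scale !expr1n; have [-> _] := clq_complete r.+1.
by have [_ ->] := clq_complete r; ring.
Qed.

End CompleteGraph.

(** * Parameters of the extremal configuration and the conclusion *)

Lemma xiP (R : realType) (c : R) : 0 < c < 1 / 2 ->
  exists2 m, xi c = m.+1 & (0 < m)%N /\
    m%:R * (1 - 2 * c) < 1 /\ 1 <= m.+1%:R * (1 - 2 * c).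
Proof.
move=> /andP[c0 c1]; have D0 : 0 < 1 - 2 * c by lra.
set t := 1 / (1 - 2 * c).
have t1 : 1 < t by rewrite ltr_pdivlMr // mul1r; lra.
(* The witness [m] is the ceiling minus 1, and the two inequalities say [m < t <= m + 1]. *)
have lo := ceilB1_lt t; have hi := ceil_ge t.
have ceil0 : 0 < Num.ceil t.
  by rewrite -(@ltr0z R); apply: lt_le_trans hi; lra.
have xiE : (xi c)%:R = (Num.ceil t)%:~R :> R.
  by rewrite /xi natr_absz gtr0_norm.
have xi0 : (0 < xi c)%N by rewrite -(ltr0n R) xiE ltr0z.
exists (xi c).-1; first by rewrite prednK.
have mE : (xi c).-1%:R + 1 = (Num.ceil t)%:~R :> R by rewrite natr1 prednK.
rewrite -(natr1 (xi c).-1) mE; have {}lo : (xi c).-1%:R < t.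
  by have := lo; rewrite intrB -mE addrK.
split; last first.
  by rewrite -ltr_pdivlMr // -ler_pdivrMr.
have : 1 < (xi c).-1%:R + 1 :> R by rewrite mE; exact: lt_le_trans hi.
by rewrite ltrDr ltr0n.
Qed.

Lemma xc_spec (R : realType) (c : R) m : 0 < c < 1 / 2 -> xi c = m.+1 ->
  (0 < m)%N -> m%:R * (1 - 2 * c) < 1 -> 1 <= m.+1%:R * (1 - 2 * c) ->
  let p := xc_big c in
  [/\ (m%:R + 1)^-1 <= p <= m%:R^-1, c2 m%:R p = 2 * c & xc_small c = 1 - m%:R * p].
Proof.
move=> /andP[c0 c1] xiE m0 lo hi p; rewrite /p /xc_big /xc_small xiE.
rewrite -(natr1 m) in hi *; set M : R := m%:R in lo hi *.
have M0 : 0 < M by rewrite ltr0n.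
have M1 : 0 < M + 1 by lra.
have Mn : M != 0 by rewrite gt_eqF.
have M1n : M + 1 != 0 by rewrite gt_eqF.
set D := 1 - _ * c.
have DE : M * D = M - 2 * (M + 1) * c by rewrite /D; field; rewrite addrK.
(* [hi] amounts to [0 <= D], where the square root is genuine; [lo] yields [M ^+ 2 * D <= 1], hence
   [p <= 1 / M]. *)
have D0 : 0 <= D.
  by rewrite -(pmulr_rge0 _ M0) DE; lra.
have MD : M ^+ 2 * D <= 1.
  rewrite expr2 -mulrA DE.
  have := ler_wpM2l (ltW M1) (ltW lo); lra.
set t := Num.sqrt D; have t0 : 0 <= t by exact: sqrtr_ge0.
have tt : t ^+ 2 = D by rewrite sqr_sqrtr.
have Mt : M * t <= 1.
  by rewrite -(@ler_pXn2r _ 2) ?nnegrE ?mulr_ge0 ?(ltW M0) // expr1n exprMn tt.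
have pE : 1 / (M + 1) + 1 / (M + 1) * t = (1 + t) / (M + 1) by field.
rewrite pE; split.
- apply/andP; split.
    by rewrite ler_pdivlMr // mulVf // lerDl.
  by rewrite ler_pdivrMr // ler_pdivlMl //; lra.
- have -> : c2 M ((1 + t) / (M + 1)) = (M - M * t ^+ 2) / (M + 1) by rewrite /c2; field.
  by rewrite tt DE; field.
- by field.
Qed.

Lemma triangle_bound_nat (R : realType) (T : finType) (m : nat) :
  (2 <= m)%N -> @triangle_bound R T m%:R.
Proof.
elim: m => // m IHm; rewrite leq_eqVlt => /orP[/eqP <-|]; first exact: triangle_bound2.
rewrite ltnS => m2; rewrite -natr1; apply: triangle_boundS; last exact: IHm.
by rewrite ler_nat.
Qed.

Lemma complete_cliques (R : realType) (c : R) m : 0 < c < 1 / 2 -> xi c = m.+1 ->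
  (0 < m)%N -> m%:R * (1 - 2 * c) < 1 -> 1 <= m.+1%:R * (1 - 2 * c) ->
  let w r := r`!%:R * Lr r (complete_mx R (xi c)) (xc c) in
  [/\ w 1%N = 1, w 2%N = 2 * c, w 3%N = f3 m%:R (xc_big c)
    & w 4%N = f4 m%:R (xc_big c)].
Proof.
move=> c0 xiE m0 lo hi w.
have [_ c2E qE] := xc_spec c0 xiE m0 lo hi.
have wE r : w r.+1 = let p := xc_big c in let M := m%:R in
    p ^+ r.+1 * \prod_(k < r.+1) (M + 1 - k%:R) +
    r.+1%:R * (1 - (M + 1) * p) * p ^+ r * \prod_(k < r) (M - k%:R).
  have [AT Aii _] := complete_weight R (xi c).
  rewrite /w Lr_clq //.
  have -> : xc c 0 = fun i : 'I_(xi c) => if (i.+1 < xi c)%N then xc_big c else xc_small c.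
    by apply/funext => i; rewrite /xc mxE.
  rewrite qE.
  (* The size [xi c] occurs in the type of the vertices and is abstracted before being replaced by
     [m.+1]. *)
  rewrite -[LHS]/((fun s => clq r.+1 (complete_mx R s)
     (fun i : 'I_s => if (i.+1 < s)%N then xc_big c else 1 - m%:R * xc_big c)) (xi c)).
  rewrite xiE /= clq_complete_uneven -natr1; ring.
by split; rewrite wE /= ?big_ord_recr ?big_ord0 /=; rewrite -?c2E /c2 /f3 /f4; ring.
Qed.

Theorem theorem1p2 (R : realType) (c : R) (hc : 0 < c < 1 / 2)
    (r : nat) (hr : r = 3%N \/ r = 4%N)
    (n : nat) (hn : (r <= xi c <= n)%N) :
  is_minimum (phi_values r n c) (phi r c).
Proof.
have [m xiE [m0 [lo hi]]] := xiP hc.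
have [pr c2E qE] := xc_spec hc xiE m0 lo hi.
have [w1 w2 w3 w4] := complete_cliques hc xiE m0 lo hi.
have m1 : 1 <= m%:R :> R by rewrite ler1n.
have [p0 _ mp _] := range_bounds m1 pr.
split.
  exists (xi c); split=> //; exists (complete_mx R (xi c), xc c); split=> //; split=> /=.
  - exact: complete_weight.
  - move=> i; rewrite mxE; case: ifP => _; first exact: ltW.
    by rewrite qE subr_ge0.
  - by rewrite -w1 mul1r.
  - by apply: (mulfI (_ : 2 != 0)); rewrite ?pnatr_eq0 // -w2.
move=> _ [k [_ [[A x] [[Aw x0 L1 L2] ->]]]] /=.
rewrite /= in Aw x0 L1 L2; have [AT Aii _] := Aw.
(* The condition [L_2 = c] reads [clq 2 = 2 * c = c2 m p], so every competitor is feasible at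
   [p = xc_big c]. *)
have fe : feasible m%:R A (x 0) (xc_big c).
  split=> //; first exact: weighting_mx.
    by split=> //; rewrite -(clq1E A) -Lr_clq // L1 mulr1.
  by rewrite c2E -Lr_clq // L2.
have f0 : 0 < r`!%:R :> R by rewrite ltr0n fact_gt0.
rewrite -(ler_pM2l f0) /phi; have /andP[rm _] := hn; rewrite xiE in rm.
case: hr => re; rewrite {}re in rm *.
  by rewrite w3 Lr_clq //; apply: triangle_bound_nat fe.
(* Here [4 <= xi c] gives [3 <= m], so the triangle bound is available for [m - 1] as well. *)
rewrite w4 Lr_clq //; apply: K4_bound fe; first by rewrite (ler_nat _ 3).
  have -> : m%:R - 1 = m.-1%:R :> R by rewrite -subn1 natrB.
  by apply: triangle_bound_nat; case: (m) rm.
by apply: triangle_bound_nat; apply: ltnW.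
Qed.
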